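(* Let $R$ be a complete local ring with maximal ideal $\mathfrak m$ and let $\Lambda$ be a Noetherian $R$-algebra which is free as an $R$-module. Set $\overline{\Lambda}^{\mathfrak m}:=\Lambda/\mathfrak m\Lambda$. Then the endomorphism ring $\mathrm{End}_{D(\Lambda)}(T)$ of a pretilting complex $T$ of $\Lambda$ is free as an $R$-module if and only if $$\mathrm{Hom}_{D(\overline\Lambda^{\mathfrak m})}(\overline T,\overline T[-1])=0,\qquad\text{where }\overline T:=T\otimes^{\mathbb L}_\Lambda\overline\Lambda^{\mathfrak m}.$$
   Context: A complete local ring means a commutative Noetherian local ring complete with respect to its maximal ideal. A Noetherian $R$-algebra is an $R$-algebra (with $R$ mapping to the center) which is finitely generated as a module over the commutative Noetherian ring $R$. A pretilting complex of $\Lambda$ is a perfect complex $T$ with $\mathrm{Hom}_{D(\Lambda)}(T,T[i])=0$ for all integers $i\neq0$, where $D(\Lambda)$ is the derived category of right $\Lambda$-modules. *)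

(* Defs.v *)
From HB Require Import structures.
From mathcomp Require Import all_boot all_order all_algebra.
From mathcomp Require Import generic_quotient ring_quotient.
From mathcomp Require Import boolp.

Set Implicit Arguments.
Unset Strict Implicit.
Unset Printing Implicit Defensive.

Import GRing.Theory.
Local Open Scope ring_scope.
Local Open Scope quotient_scope.

Section CommutativeRings.
Variable R : comNzRingType.
Implicit Types I J m : R -> Prop.

Definition is_ideal I :=
  [/\ I 0, forall x y, I x -> I y -> I (x + y) & forall a x, I x -> I (a * x)].

Definition noetherian :=
  forall I, is_ideal I ->
    exists n (g : 'I_n -> R), forall x,
      I x <-> exists c : 'I_n -> R, x = \sum_k c k * g k.

Definition maximal_ideal m :=
  [/\ is_ideal m, ~ m 1 &
      forall I, is_ideal I -> ~ I 1 -> (forall x, m x -> I x) ->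
        forall x, I x -> m x].

Definition local_with m :=
  maximal_ideal m /\
  forall m', maximal_ideal m' -> forall x, m' x <-> m x.

Definition ideal_mul I J : R -> Prop := fun x =>
  exists n (a b : 'I_n -> R),
    [/\ forall k, I (a k), forall k, J (b k) & x = \sum_k a k * b k].

Fixpoint ideal_exp I (n : nat) : R -> Prop :=
  if n is n'.+1 then ideal_mul I (ideal_exp I n') else fun=> True.

(* The canonical map from R to the inverse limit of the R / m^n is injective
   and surjective; a compatible system is represented by lifts [u n]. *)
Definition adically_complete m :=
  (forall x, (forall n, ideal_exp m n x) -> x = 0) /\
  (forall u : nat -> R, (forall n, ideal_exp m n (u n.+1 - u n)) ->
     exists l, forall n, ideal_exp m n (l - u n)).

Definition complete_local_ring m :=
  [/\ noetherian, local_with m & adically_complete m].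

End CommutativeRings.

(* [M] carries an R-module structure, given by its zero and by the relation
   "[c] is the linear combination of the [a k] with coefficients [r k]".
   Morphisms in the derived category are added by first reducing them to a
   common denominator; moreover they form a type too large to be the carrier
   of an [lmodType].  Hence this relational presentation. *)
Definition is_free (R : pzRingType) (M : Type) (zero : M)
    (lincomb : forall n, ('I_n -> R) -> ('I_n -> M) -> M -> Prop) :=
  exists (I : Type) (e : I -> M),
    (forall c, exists n (k : 'I_n -> I) (r : 'I_n -> R),
       lincomb n r (fun l => e (k l)) c) /\
    (forall n (k : 'I_n -> I) (r : 'I_n -> R), injective k ->
       lincomb n r (fun l => e (k l)) zero -> forall l, r l = 0).

(* The library's [algType] excludes the zero algebra. *)
Record ralgebra (R : comNzRingType) := RAlgebra {
  alg_ring :> pzRingType;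
  alg_map : {rmorphism R -> alg_ring};
  alg_central : forall r x, alg_map r * x = x * alg_map r }.

Section Algebras.
Variables (R : comNzRingType) (L : ralgebra R).

Definition alg_lincomb n (r : 'I_n -> R) (a : 'I_n -> L) (c : L) :=
  c = \sum_k alg_map L (r k) * a k.

Definition noetherian_algebra :=
  noetherian R /\
  exists n (g : 'I_n -> L), forall x, exists r, alg_lincomb r g x.

Definition alg_free := is_free 0 alg_lincomb.

End Algebras.

Section Reduction.
Variables (R : comNzRingType) (m : R -> Prop) (L : ralgebra R).

Definition in_mL (x : L) :=
  exists n (a : 'I_n -> R) (y : 'I_n -> L),
    (forall k, m (a k)) /\ x = \sum_k alg_map L (a k) * y k.

Definition mL : {pred L} := fun x => `[< in_mL x >].

Lemma mLP x : reflect (in_mL x) (x \in mL).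
Proof. exact: asboolP. Qed.

Lemma mL_add x y : in_mL x -> in_mL y -> in_mL (x + y).
Proof.
move=> [n [a [u [ma ->]]]] [p [b [v [mb ->]]]].
exists (n + p)%N,
  (fun k => match split k with inl i => a i | inr j => b j end),
  (fun k => match split k with inl i => u i | inr j => v j end); split.
  by move=> k; case: (split k).
rewrite big_split_ord /=; congr (_ + _); apply: eq_bigr => k _.
  by rewrite -[lshift p k]/(unsplit (inl k)) unsplitK.
by rewrite -[rshift n k]/(unsplit (inr k)) unsplitK.
Qed.

Lemma mL_mulr x y : in_mL x -> in_mL (x * y).
Proof.
move=> [n [a [u [ma ->]]]]; exists n, a, (fun k => u k * y); split=> //.
by rewrite mulr_suml; apply: eq_bigr => k _; rewrite mulrA.
Qed.

Lemma mL_mull x y : in_mL x -> in_mL (y * x).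
Proof.
move=> [n [a [u [ma ->]]]]; exists n, a, (fun k => y * u k); split=> //.
rewrite mulr_sumr; apply: eq_bigr => k _.
by rewrite mulrA -alg_central mulrA.
Qed.

Lemma mL_zmod_closed : zmod_closed mL.
Proof.
split; first by apply/mLP; exists 0%N, (fun=> 0), (fun=> 0); split=> [[]|] //; rewrite big_ord0.
move=> x y /mLP hx /mLP hy; apply/mLP/mL_add => //.
by rewrite -mulrN1; apply: mL_mulr.
Qed.

HB.instance Definition _ := GRing.isZmodClosed.Build L mL mL_zmod_closed.


Definition redL := Quotient.quot mL.
HB.instance Definition _ := GRing.Zmodule.on redL.
HB.instance Definition _ := EqQuotient.on redL.

Lemma redL_eqP (x y : L) : reflect (\pi_redL x = \pi_redL y) (x - y \in mL).
Proof. by rewrite Quotient.idealrBE; apply: eqP. Qed.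

Lemma redL_piD (x y : L) : \pi_redL (x + y) = \pi_redL x + \pi_redL y.
Proof. exact: (Quotient.pi_add mL). Qed.

Definition redL_one : redL := \pi_redL 1.
Definition redL_mul (a b : redL) : redL := \pi_redL (repr a * repr b).

Lemma redL_piM (x y : L) : \pi_redL (x * y) = redL_mul (\pi_redL x) (\pi_redL y).
Proof.
apply/redL_eqP/mLP.
have hx : x - repr (\pi_redL x) \in mL by apply/redL_eqP; rewrite reprK.
have hy : y - repr (\pi_redL y) \in mL by apply/redL_eqP; rewrite reprK.
set x' := repr _ in hx *; set y' := repr _ in hy *.
have -> : x * y - x' * y' = (x - x') * y + x' * (y - y').
  by rewrite mulrBl mulrBr addrA subrK.
by apply: mL_add; [apply/mL_mulr/mLP | apply/mL_mull/mLP].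
Qed.

Lemma redL_mulA : associative redL_mul.
Proof.
move=> a b c; rewrite -[a]reprK -[b]reprK -[c]reprK.
by rewrite -(redL_piM (repr b)) -(redL_piM (repr a) (repr b)) -!redL_piM mulrA.
Qed.

Lemma redL_mul1 : left_id redL_one redL_mul.
Proof. by move=> a; rewrite -[a]reprK -redL_piM mul1r. Qed.

Lemma redL_mulr1 : right_id redL_one redL_mul.
Proof. by move=> a; rewrite -[a]reprK -redL_piM mulr1. Qed.

Lemma redL_mulDl : left_distributive redL_mul +%R.
Proof.
by move=> a b c; rewrite -[a]reprK -[b]reprK -[c]reprK
  -redL_piD -!redL_piM -redL_piD mulrDl.
Qed.

Lemma redL_mulDr : right_distributive redL_mul +%R.
Proof.
by move=> a b c; rewrite -[a]reprK -[b]reprK -[c]reprK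
  -redL_piD -!redL_piM -redL_piD mulrDr.
Qed.

HB.instance Definition _ := GRing.Zmodule_isPzRing.Build redL
  redL_mulA redL_mul1 redL_mulr1 redL_mulDl redL_mulDr.

Definition red_map (x : L) : redL := \pi_redL x.

Lemma red_map_zmod : zmod_morphism red_map.
Proof.
move=> x y; apply: (addIr (red_map y)).
by rewrite /red_map -redL_piD !subrK.
Qed.

HB.instance Definition _ := GRing.isZmodMorphism.Build L redL red_map red_map_zmod.

Lemma red_map_monoid : monoid_morphism red_map.
Proof. by split=> // x y; apply: redL_piM. Qed.

HB.instance Definition _ := GRing.isMonoidMorphism.Build L redL red_map red_map_monoid.

End Reduction.

(* Right modules over a ring A are left modules over the converse ring A^c:
   the right action x.a is written (a : A^c) *: x.  For a ring morphism
   pi : A -> B, the right B-module tensorB M is the tensor product of the right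
   A-module M with the A-B-bimodule B: generators are pairs (x, b), words are
   formal sums of generators. *)
Section TensorProduct.
Variables (A B : pzRingType) (pi : {rmorphism A -> B}).

Section Object.
Variable M : lmodType A^c.

Definition tword := seq (M * B).

Inductive trel : tword -> tword -> Prop :=
| trel_refl w : trel w w
| trel_sym w w' : trel w w' -> trel w' w
| trel_trans w' w w'' : trel w w' -> trel w' w'' -> trel w w''
| trel_cat w1 w1' w2 w2' :
    trel w1 w1' -> trel w2 w2' -> trel (w1 ++ w2) (w1' ++ w2')
| trel_comm w w' : trel (w ++ w') (w' ++ w)
| trel_zero b : trel [:: (0, b)] [::]
| trel_addl x y b : trel [:: (x + y, b)] [:: (x, b); (y, b)]
| trel_addr x b c : trel [:: (x, b + c)] [:: (x, b); (x, c)]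
| trel_bal x (a : A) b : trel [:: ((a : A^c) *: x, b)] [:: (x, pi a * b)].

Definition trelb : rel tword := fun w w' => `[< trel w w' >].

Lemma trelb_equiv : equiv_class_of trelb.
Proof.
split=> [w|w w'|w' w w''].
- exact/asboolP/trel_refl.
- by apply/idP/idP=> /asboolP h; apply/asboolP/trel_sym.
- by move=> /asboolP h /asboolP h'; apply/asboolP/(trel_trans h h').
Qed.

Canonical trelb_equivRel := EquivRelPack trelb_equiv.
Canonical trelb_encModRel := defaultEncModRel trelb.

Definition tensorB := {eq_quot trelb}.
HB.instance Definition _ := EqQuotient.on tensorB.
HB.instance Definition _ := Choice.on tensorB.

Lemma tensorBP (w w' : tword) : trel w w' <-> \pi_tensorB w = \pi_tensorB w'.
Proof.
by split=> [h|/eqmodP/asboolP //]; apply/eqmodP/asboolP.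
Qed.

Lemma trel_repr w : trel (repr (\pi_tensorB w)) w.
Proof. by apply/tensorBP; rewrite reprK. Qed.

Definition topp (w : tword) : tword := [seq (- p.1, p.2) | p <- w].

Definition tact (c : B) (w : tword) : tword := [seq (p.1, p.2 * c) | p <- w].

Lemma trel_topp w w' : trel w w' -> trel (topp w) (topp w').
Proof.
elim=> {w w'} [w|w w' _|w' w w'' _ h _|w1 w1' w2 w2' _ h1 _ h2|w w'|b|x y b|x b c|x a b].
- exact: trel_refl.
- exact: trel_sym.
- exact: trel_trans h.
- by rewrite /topp !map_cat; apply: trel_cat.
- by rewrite /topp !map_cat; apply: trel_comm.
- by rewrite /= oppr0; apply: trel_zero.
- by rewrite /= opprD; apply: trel_addl.
- exact: trel_addr.
- by rewrite /= -scalerN; apply: trel_bal.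
Qed.

Lemma trel_tact c w w' : trel w w' -> trel (tact c w) (tact c w').
Proof.
elim=> {w w'} [w|w w' _|w' w w'' _ h _|w1 w1' w2 w2' _ h1 _ h2|w w'|b|x y b|x b d|x a b].
- exact: trel_refl.
- exact: trel_sym.
- exact: trel_trans h.
- by rewrite /tact !map_cat; apply: trel_cat.
- by rewrite /tact !map_cat; apply: trel_comm.
- exact: trel_zero.
- exact: trel_addl.
- by rewrite /= mulrDl; apply: trel_addr.
- by rewrite /= -mulrA; apply: trel_bal.
Qed.

Lemma trel_toppK w : trel (topp w ++ w) [::].
Proof.
elim: w => [|[x b] w ih] /=; first exact: trel_refl.
apply: (@trel_trans ([:: (- x, b); (x, b)] ++ (topp w ++ w))).
  have := trel_cat (trel_refl [:: (- x, b)])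
    (trel_cat (trel_comm (topp w) [:: (x, b)]) (trel_refl w)).
  by rewrite -catA.
apply: (@trel_trans ([::] ++ [::])); last exact: trel_refl.
apply: trel_cat => //.
apply: trel_trans (trel_zero b).
by rewrite -(addNr x); apply/trel_sym/trel_addl.
Qed.

Lemma trel_tactD c d w : trel (tact (c + d) w) (tact c w ++ tact d w).
Proof.
elim: w => [|[x b] w ih] /=; first exact: trel_refl.
apply: (@trel_trans ([:: (x, b * c); (x, b * d)] ++ (tact c w ++ tact d w))).
  rewrite -[_ :: _]/([:: (x, b * (c + d))] ++ tact (c + d) w).
  by apply: trel_cat => //; rewrite mulrDr; apply: trel_addr.
have := trel_cat (trel_refl [:: (x, b * c)])
  (trel_cat (trel_comm [:: (x, b * d)] (tact c w)) (trel_refl (tact d w))).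
by rewrite -!catA.
Qed.

Definition tensorB_zero : tensorB := \pi_tensorB [::].
Definition tensorB_add (u v : tensorB) : tensorB := \pi_tensorB (repr u ++ repr v).
Definition tensorB_opp (u : tensorB) : tensorB := \pi_tensorB (topp (repr u)).
Definition tensorB_scale (c : B^c) (u : tensorB) : tensorB :=
  \pi_tensorB (tact c (repr u)).

Lemma tensorB_piD w w' :
  \pi_tensorB (w ++ w') = tensorB_add (\pi_tensorB w) (\pi_tensorB w').
Proof. by apply/tensorBP/trel_cat; apply/trel_sym/trel_repr. Qed.

Lemma tensorB_piN w : \pi_tensorB (topp w) = tensorB_opp (\pi_tensorB w).
Proof. by apply/tensorBP/trel_topp/trel_sym/trel_repr. Qed.

Lemma tensorB_piZ c w : \pi_tensorB (tact c w) = tensorB_scale c (\pi_tensorB w).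
Proof. by apply/tensorBP/trel_tact/trel_sym/trel_repr. Qed.

Lemma tensorB_addA : associative tensorB_add.
Proof.
move=> u v w; rewrite -[u]reprK -[v]reprK -[w]reprK.
by rewrite -(tensorB_piD (repr v)) -(tensorB_piD (repr u) (repr v)) -!tensorB_piD catA.
Qed.

Lemma tensorB_addC : commutative tensorB_add.
Proof.
move=> u v; rewrite -[u]reprK -[v]reprK -!tensorB_piD.
exact/tensorBP/trel_comm.
Qed.

Lemma tensorB_add0 : left_id tensorB_zero tensorB_add.
Proof. by move=> u; rewrite -[u]reprK -tensorB_piD. Qed.

Lemma tensorB_addN : left_inverse tensorB_zero tensorB_opp tensorB_add.
Proof.
move=> u; rewrite -[u]reprK -tensorB_piN -tensorB_piD.
exact/tensorBP/trel_toppK.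
Qed.

HB.instance Definition _ := GRing.isZmodule.Build tensorB
  tensorB_addA tensorB_addC tensorB_add0 tensorB_addN.

Lemma tensorB_scaleA c d u :
  tensorB_scale c (tensorB_scale d u) = tensorB_scale (c * d) u.
Proof.
rewrite -[u]reprK -(tensorB_piZ d) -!tensorB_piZ; congr (\pi_tensorB _).
by rewrite /tact -map_comp; apply: eq_map => -[x b] /=; rewrite -mulrA.
Qed.

Lemma tensorB_scale1 : left_id 1 tensorB_scale.
Proof.
move=> u; rewrite -[u]reprK -tensorB_piZ; congr (\pi_tensorB _).
by rewrite /tact -[RHS]map_id; apply: eq_map => -[x b] /=; rewrite mulr1.
Qed.

Lemma tensorB_scaleDr : right_distributive tensorB_scale +%R.
Proof.
move=> c u v; rewrite -[u]reprK -[v]reprK.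
by rewrite -[_ + _]tensorB_piD -!tensorB_piZ /tact map_cat [LHS]tensorB_piD.
Qed.

Lemma tensorB_scaleDl u : {morph tensorB_scale^~ u : c d / c + d}.
Proof.
move=> c d; rewrite -[u]reprK -!tensorB_piZ -[RHS]tensorB_piD.
exact/tensorBP/trel_tactD.
Qed.

HB.instance Definition _ := GRing.Zmodule_isLmodule.Build B^c tensorB
  tensorB_scaleA tensorB_scale1 tensorB_scaleDr tensorB_scaleDl.

End Object.

Section Morphism.
Variables (M N : lmodType A^c) (f : {linear M -> N}).

Definition tword_map (w : tword M) : tword N := [seq (f p.1, p.2) | p <- w].

Lemma trel_map w w' : trel w w' -> trel (tword_map w) (tword_map w').
Proof.
elim=> {w w'} [w|w w' _|w' w w'' _ h _|w1 w1' w2 w2' _ h1 _ h2|w w'|b|x y b|x b d|x a b].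
- exact: trel_refl.
- exact: trel_sym.
- exact: trel_trans h.
- by rewrite /tword_map !map_cat; apply: trel_cat.
- by rewrite /tword_map !map_cat; apply: trel_comm.
- by rewrite /= linear0; apply: trel_zero.
- by rewrite /= linearD; apply: trel_addl.
- exact: trel_addr.
- by rewrite /= linearZ; apply: trel_bal.
Qed.

Definition tensorB_map (u : tensorB M) : tensorB N :=
  \pi_(tensorB N) (tword_map (repr u)).

Lemma tensorB_piM w :
  tensorB_map (\pi_(tensorB M) w) = \pi_(tensorB N) (tword_map w).
Proof. exact/tensorBP/trel_map/trel_repr. Qed.

Lemma tensorB_map_linear : linear tensorB_map.
Proof.
move=> c u v; rewrite -[u]reprK -[v]reprK.
have hZ (K : lmodType A^c) w : c *: \pi_(tensorB K) w = \pi_(tensorB K) (tact c w).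
  by rewrite tensorB_piZ.
have hD (K : lmodType A^c) (w w' : tword K) :
  \pi_(tensorB K) w + \pi_(tensorB K) w' = \pi_(tensorB K) (w ++ w').
  by rewrite tensorB_piD.
rewrite hZ hD !tensorB_piM hZ hD /tword_map map_cat; congr (\pi_(tensorB N) (_ ++ _)).
by rewrite /tact -!map_comp.
Qed.

HB.instance Definition _ :=
  GRing.isLinear.Build B^c (tensorB M) (tensorB N) *:%R tensorB_map tensorB_map_linear.

End Morphism.
End TensorProduct.

Arguments tensorB_map {A B} pi {M N} f u.
Arguments tensorB_piM {A B} pi {M N} f w.

(* Cochain complexes of left A-modules.  The differential is a family indexed
   by all pairs (i, j), required to vanish unless j = i + 1; this avoids
   transports along equalities of degrees, notably for shifts. *)
Record complex (A : pzRingType) := Complex {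
  cobj :> int -> lmodType A;
  cdiff : forall i j, {linear cobj i -> cobj j};
  cdiff_shape : forall i j, j <> i + 1 -> forall x, cdiff i j x = 0;
  cdiffK : forall i j k x, cdiff j k (cdiff i j x) = 0 }.

Record chain_map (A : pzRingType) (X Y : complex A) := ChainMap {
  chain_fun :> forall i, {linear X i -> Y i};
  chain_comm : forall i j x,
    chain_fun j (cdiff X i j x) = cdiff Y i j (chain_fun i x) }.

Section Complexes.
Variable A : pzRingType.
Implicit Types X Y Z : complex A.

Definition chain_id X : chain_map X X :=
  @ChainMap A X X (fun i => idfun) (fun _ _ _ => erefl).

Definition chain_comp X Y Z (g : chain_map Y Z) (f : chain_map X Y) :
  chain_map X Z.
Proof.
exists (fun i => g i \o f i : {linear X i -> Z i}) => i j x /=.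
by rewrite !chain_comm.
Defined.

Definition chain_zero X Y : chain_map X Y.
Proof. by exists (fun i => \0 : {linear X i -> Y i}) => i j x /=; rewrite linear0. Defined.

Definition shift_sign (M N : lmodType A) (n : int) (f : {linear M -> N}) (x : M) : N :=
  if odd `|n|%N then - f x else f x.

Lemma shift_sign_linear (M N : lmodType A) n (f : {linear M -> N}) : linear (@shift_sign M N n f).
Proof.
move=> a x y; rewrite /shift_sign; case: ifP => _; rewrite linearP //.
by rewrite opprD scalerN.
Qed.

HB.instance Definition _ (M N : lmodType A) n (f : {linear M -> N}) :=
  GRing.isLinear.Build A M N *:%R (@shift_sign M N n f) (@shift_sign_linear M N n f).

(* X[n], with differential (-1)^n d. *)
Definition shift X (n : int) : complex A.
Proof.
exists (fun i => X (i + n))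
  (fun i j => @shift_sign (X (i + n)) (X (j + n)) n (cdiff X (i + n) (j + n))
     : {linear _ -> _}) => [i j ne x|i j k x] /=; rewrite /shift_sign.
  rewrite cdiff_shape ?oppr0 ?if_same // => e; apply: ne.
  by apply: (addIr n); rewrite addrAC.
by case: (odd _) => /=; rewrite ?(linearN (cdiff X _ _)) cdiffK ?oppr0.
Defined.

Definition cocycle X i (x : X i) := forall j, cdiff X i j x = 0.
Definition coboundary X i (x : X i) := exists j y, cdiff X j i y = x.

Definition acyclic X := forall i (x : X i), cocycle x -> coboundary x.

(* Injectivity and surjectivity of the maps induced on cohomology. *)
Definition quasi_iso X Y (f : chain_map X Y) :=
  forall i,
    (forall x : X i, cocycle x -> coboundary (f i x) -> coboundary x) /\
    (forall y : Y i, cocycle y -> exists2 x : X i, cocycle x & coboundary (y - f i x)).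

Definition homotopic X Y (f g : chain_map X Y) :=
  exists h : forall i j, {linear X i -> Y j}, forall i x,
    f i x - g i x =
      cdiff Y (i - 1) i (h i (i - 1) x) + h (i + 1) i (cdiff X i (i + 1) x).

Definition K_projective P :=
  forall Z (f : chain_map P Z), acyclic Z -> homotopic f (chain_zero P Z).

Lemma quasi_iso_id X : quasi_iso (chain_id X).
Proof.
move=> i; split=> // y hy; exists y => //; exists i, 0.
by rewrite linear0 /= subrr.
Qed.

(* A roof X <-den- apex -num-> Y represents the morphism num / den of the
   derived category D(A), the localization of the homotopy category of
   complexes at quasi-isomorphisms; two roofs represent the same morphism
   when they are dominated by a common one. *)
Record roof X Y := Roof {
  apex : complex A;
  den : chain_map apex X;
  den_quasi_iso : quasi_iso den;
  num : chain_map apex Y }.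

Definition roof_eq X Y (a b : roof X Y) :=
  exists (W : complex A) (u : chain_map W (apex a)) (v : chain_map W (apex b)),
    [/\ quasi_iso (chain_comp (den a) u),
        homotopic (chain_comp (den a) u) (chain_comp (den b) v) &
        homotopic (chain_comp (num a) u) (chain_comp (num b) v)].

Definition roof_zero X Y : roof X Y := Roof (@quasi_iso_id X) (chain_zero X Y).

(* Hom_{D(A)}(X, Y) = 0. *)
Definition derived_Hom_zero X Y := forall a : roof X Y, roof_eq a (roof_zero X Y).

Definition derived_iso X Y := exists a : roof X Y, quasi_iso (num a).

Definition fin_gen (M : lmodType A) :=
  exists n (g : 'I_n -> M), forall x, exists c : 'I_n -> A, x = \sum_k c k *: g k.

Definition projective (M : lmodType A) :=
  forall (N N' : lmodType A) (p : {linear N -> N'}) (f : {linear M -> N'}),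
    (forall y, exists x, p x = y) ->
    exists g : {linear M -> N}, forall x, p (g x) = f x.

Definition strictly_perfect X :=
  (forall i, fin_gen (X i) /\ projective (X i)) /\
  exists n : int, forall i, n < `|i| -> forall x : X i, x = 0.

Definition perfect X := exists2 P, strictly_perfect P & derived_iso P X.

Definition pretilting T :=
  perfect T /\ forall i : int, i <> 0 -> derived_Hom_zero T (shift T i).

End Complexes.

Section LinearStructure.
Variables (R : comNzRingType) (L : ralgebra R) (X Y : complex (L : pzRingType)^c).

(* The R-module structure of Hom_{D(L)}(X, Y), D(L) being the derived category
   of right L-modules: fractions with the same denominator are combined on
   numerators, on which R acts through its image in the center of L. *)
Definition derived_lincomb n (r : 'I_n -> R) (a : 'I_n -> roof X Y) (c : roof X Y) :=
  exists (Z : complex (L : pzRingType)^c) (s : chain_map Z X) (qs : quasi_iso s)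
         (f : 'I_n -> chain_map Z Y) (g : chain_map Z Y),
    [/\ forall k, roof_eq (a k) (Roof qs (f k)),
        forall i x, g i x = \sum_k (alg_map L (r k) : L^c) *: f k i x &
        roof_eq c (Roof qs g)].

Definition derived_Hom_free := is_free (roof_zero X Y) derived_lincomb.

End LinearStructure.

Section ExtensionOfScalars.
Variables (A B : pzRingType) (pi : {rmorphism A -> B}) (P : complex A^c).

Lemma tensorB_map0 (M N : lmodType A^c) (f : {linear M -> N}) u :
  (forall x, f x = 0) -> tensorB_map pi f u = 0.
Proof.
move=> f0; rewrite -[u]reprK tensorB_piM; move: (repr u) => w.
apply/tensorBP; elim: w => [|[x b] w ih] /=; first exact: trel_refl.
by rewrite f0; apply: (trel_cat (trel_zero pi _ b) ih).
Qed.

Lemma extend_shape i j : j <> i + 1 ->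
  forall u, tensorB_map pi (cdiff P i j) u = 0.
Proof. by move=> ne u; apply: tensorB_map0; apply: cdiff_shape. Qed.

Lemma extend_diffK i j k u :
  tensorB_map pi (cdiff P j k) (tensorB_map pi (cdiff P i j) u) = 0.
Proof.
rewrite -(tensorB_map0 (f := cdiff P j k \o cdiff P i j) u); last exact: cdiffK.
rewrite -[u]reprK (tensorB_piM pi (cdiff P i j)) !tensorB_piM.
by rewrite /tword_map -map_comp.
Qed.

Definition extend_scalars : complex B^c :=
  @Complex B^c (fun i => tensorB pi (P i))
    (fun i j => tensorB_map pi (cdiff P i j)) extend_shape extend_diffK.

End ExtensionOfScalars.

(* T (x)^L_A B is computed by extending the scalars of a K-projective complex
   quasi-isomorphic to T. *)
Definition derived_extension (A B : pzRingType) (pi : {rmorphism A -> B})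
    (T : complex A^c) (TB : complex B^c) :=
  exists (P : complex A^c) (q : chain_map P T),
    [/\ K_projective P, quasi_iso q & derived_iso TB (extend_scalars pi P)].

(* Main.v *)
Require Import Defs.
From HB Require Import structures.
From mathcomp Require Import all_boot all_order all_algebra.
From mathcomp Require Import generic_quotient ring_quotient boolp.
From mathcomp Require Import zify ring.

(* Replace T by a strictly perfect complex P and let E = Hom(P, P), a bounded
   complex of finitely generated projective R-modules with
   H^n(E) = Hom_D(T, T[n]).  As Lambda is free over R and P is projective,
   E / m E is the Hom complex of P (x) Lambda / m Lambda, so the claim reads:
   H^0(E) is free iff H^{-1}(E / m E) = 0.  Exactness of E in positive degrees
   makes the cocycles Z^0(E) a direct summand of E^0, so E in degrees <= 0 is a
   projective resolution of H^0(E), and H^{-1}(E / m E) = Tor_1(H^0(E), R / m).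
   Concretely, if this vanishes, the module K of relations between the elements
   of a minimal generating system of H^0(E) satisfies K = m K, so K lies in all
   the powers of m and is 0.  Conversely, if H^0(E) is free, a cochain h of
   degree -1 with d h in m E is corrected by an element of m E to a cocycle,
   which is a coboundary since H^{-1}(E) = 0. *)

Set Implicit Arguments.
Unset Strict Implicit.
Unset Printing Implicit Defensive.

Import Order.TTheory GRing.Theory Num.Theory.
Local Open Scope ring_scope.

(** * Homotopies, quasi-isomorphisms and shifts *)

(** Morphisms of D(Lambda) are classes of roofs, so every statement about them is first carried to
    chain maps out of a K-projective complex, where equality becomes homotopy. Two obstacles shape
    the rest. A chain map between reductions lifts only degreewise, by projectivity, and the lift
    commutes with the differentials only modulo m; hence H^{-1}(E / m E) = 0 is expressed inside E,
    by elements h of degree -1 with d h in m E. Moreover, reduction kills the maps whose values lie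
    in m P, whereas the algebra needs sums of a_t y_t with a_t in m and y_t in E. The two agree
    because E^n has a finite dual basis over R, obtained from dual bases of the P^i over Lambda and
    a finite basis of Lambda over R. Finally, K = m K needs coordinates of cocycles that depend
    linearly on the cocycle; these come from the dual basis of E^0. *)

Section MkLinear.
Variables (A : pzRingType) (M N : lmodType A) (f : M -> N) (fP : linear f).
(** The proof of linearity is a parameter of the function, so that the instance declared next can be
    inferred from the term alone. *)
Definition linear_fun of linear f := f.
HB.instance Definition _ :=
  GRing.isLinear.Build A M N *:%R (linear_fun fP) fP.
Definition mk_linear : {linear M -> N} := linear_fun fP.
End MkLinear.
Arguments linear_fun {A M N f} fP / x.

Section Cast.
Variable A : pzRingType.
Implicit Types X Y : complex A.

(* A total cast, equal to 0 unless [i = j]: no equality proof occurs in terms. *)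
Definition pcast X i j : {linear X i -> X j} :=
  match i =P j with
  | ReflectT e => ecast k {linear X i -> X k} e idfun
  | ReflectF _ => \0
  end.

Lemma pcast_id X i x : pcast X i i x = x.
Proof. by rewrite /pcast; case: eqP => // e; rewrite eq_axiomK. Qed.

Lemma pcast0 X i j x : i <> j -> pcast X i j x = 0.
Proof. by rewrite /pcast; case: eqP. Qed.

Lemma pcast_trans X i j k x : i = j -> pcast X j k (pcast X i j x) = pcast X i k x.
Proof. by move=> e; case: _ / e; rewrite pcast_id. Qed.

Lemma cdiff_pcast X i j k x : i = j -> cdiff X j k (pcast X i j x) = cdiff X i k x.
Proof. by move=> e; case: _ / e; rewrite pcast_id. Qed.

Lemma pcast_cdiff X i j k x : j = k -> pcast X j k (cdiff X i j x) = cdiff X i k x.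
Proof. by move=> e; case: _ / e; rewrite pcast_id. Qed.

End Cast.

Section Homotopy.
Variable A : pzRingType.
Implicit Types X Y Z W : complex A.

Lemma homotopic_ext X Y (f g : chain_map X Y) :
  (forall i x, f i x = g i x) -> homotopic f g.
Proof.
move=> e; exists (fun i j => \0 : {linear X i -> Y j}) => i x /=.
by rewrite e subrr linear0 addr0.
Qed.

Lemma homotopic_refl X Y (f : chain_map X Y) : homotopic f f.
Proof. exact: homotopic_ext. Qed.

Lemma homotopic_sym X Y (f g : chain_map X Y) : homotopic f g -> homotopic g f.
Proof.
move=> [h hP]; exists (fun i j => \- (h i j) : {linear X i -> Y j}) => i x /=.
by rewrite -opprB hP linearN opprD.
Qed.

Lemma homotopic_trans X Y (f g k : chain_map X Y) :
  homotopic f g -> homotopic g k -> homotopic f k.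
Proof.
move=> [h hP] [h' hP'].
exists (fun i j => (h i j \+ h' i j) : {linear X i -> Y j}) => i x /=.
by rewrite -(subrKA (g i x)) hP hP' linearD /= addrACA.
Qed.

Lemma homotopic_compl X Y Z (g : chain_map Y Z) (f f' : chain_map X Y) :
  homotopic f f' -> homotopic (chain_comp g f) (chain_comp g f').
Proof.
move=> [h hP]; exists (fun i j => (g j \o h i j) : {linear X i -> Z j}) => i x /=.
by rewrite -linearB hP linearD chain_comm.
Qed.

Lemma homotopic_compr X Y Z (g g' : chain_map Y Z) (f : chain_map X Y) :
  homotopic g g' -> homotopic (chain_comp g f) (chain_comp g' f).
Proof.
move=> [h hP]; exists (fun i j => (h i j \o f i) : {linear X i -> Z j}) => i x /=.
by rewrite hP -chain_comm.
Qed.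

Lemma cocycleB X i (x y : X i) : cocycle x -> cocycle y -> cocycle (x - y).
Proof. by move=> hx hy j; rewrite linearB hx hy subr0. Qed.

Lemma cocycleP X i j (x : X i) : j = i + 1 -> cdiff X i j x = 0 -> cocycle x.
Proof.
move=> -> hx k; have [->//|/eqP ne] := eqVneq k (i + 1).
exact: cdiff_shape.
Qed.

Lemma coboundaryP X i (x : X i) j :
  i = j + 1 -> coboundary x -> exists y : X j, cdiff X j i y = x.
Proof.
move=> e [k [y <-]]; have [ek|/eqP ne] := eqVneq k j.
  by rewrite -ek; exists y.
(* From any other degree the differential is zero, so the coboundary is 0. *)
exists 0; rewrite linear0 cdiff_shape // => e'; apply: ne.
by apply: (addIr 1); rewrite -e -e'.
Qed.

Lemma coboundaryD X i (x y : X i) : coboundary x -> coboundary y -> coboundary (x + y).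
Proof.
have e : i = i - 1 + 1 by rewrite subrK.
move=> /(coboundaryP e) [u <-] /(coboundaryP e) [v <-].
by exists (i - 1), (u + v); rewrite linearD.
Qed.

Lemma coboundaryN X i (x : X i) : coboundary x -> coboundary (- x).
Proof. by move=> [j [y <-]]; exists j, (- y); rewrite linearN. Qed.

Lemma coboundaryB X i (x y : X i) : coboundary x -> coboundary y -> coboundary (x - y).
Proof. by move=> hx hy; apply: coboundaryD => //; apply: coboundaryN. Qed.

Lemma chain_cocycle X Y (f : chain_map X Y) i (x : X i) : cocycle x -> cocycle (f i x).
Proof. by move=> hx j; rewrite -chain_comm hx linear0. Qed.

Lemma chain_coboundary X Y (f : chain_map X Y) i (x : X i) :
  coboundary x -> coboundary (f i x).
Proof. by move=> [j [y <-]]; exists j, (f j y); rewrite chain_comm. Qed.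

Lemma homotopic_coboundary X Y (f g : chain_map X Y) i (x : X i) :
  homotopic f g -> cocycle x -> coboundary (f i x - g i x).
Proof.
move=> [h hP] hx; rewrite hP hx linear0 addr0.
by exists (i - 1), (h i (i - 1) x).
Qed.

Lemma quasi_iso_homotopic X Y (f g : chain_map X Y) :
  homotopic f g -> quasi_iso f -> quasi_iso g.
Proof.
move=> hfg qf i; have [inj surj] := qf i; split=> [x cx bx|y cy].
  apply: inj => //; rewrite -(subrK (g i x) (f i x)).
  by apply: coboundaryD => //; apply: homotopic_coboundary.
have [x cx bx] := surj y cy; exists x => //.
rewrite -(subrKA (f i x)); apply: coboundaryD => //.
exact: homotopic_coboundary.
Qed.

Lemma quasi_iso_comp X Y Z (g : chain_map Y Z) (f : chain_map X Y) :
  quasi_iso g -> quasi_iso f -> quasi_iso (chain_comp g f).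
Proof.
move=> qg qf i; have [ig sg] := qg i; have [if_ sf] := qf i; split=> [x cx /= bx|z cz].
  by apply: if_ => //; apply: ig => //; apply: chain_cocycle.
have [y cy by_] := sg z cz; have [x cx bx] := sf y cy; exists x => //=.
rewrite -(subrKA (g i y)); apply: coboundaryD => //.
by rewrite -linearB; apply: chain_coboundary.
Qed.

Lemma quasi_iso_cancel X Y Z (g : chain_map Y Z) (f : chain_map X Y) :
  quasi_iso g -> quasi_iso (chain_comp g f) -> quasi_iso f.
Proof.
move=> qg qgf i; have [ig sg] := qg i; have [igf sgf] := qgf i; split=> [x cx bx|y cy].
  by apply: igf => //=; apply: chain_coboundary.
have [x cx /= bx] := sgf (g i y) (chain_cocycle g cy); exists x => //.
apply: ig; first by apply: cocycleB => //; apply: chain_cocycle.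
by rewrite linearB.
Qed.

Lemma homotopy_equiv_quasi_iso X Y (f : chain_map X Y) (g : chain_map Y X) :
  homotopic (chain_comp g f) (chain_id X) ->
  homotopic (chain_comp f g) (chain_id Y) -> quasi_iso f.
Proof.
move=> gf fg i; split=> [x cx bx|y cy].
  rewrite -(subKr (g i (f i x)) x); apply: coboundaryB.
    exact: chain_coboundary.
  exact: (homotopic_coboundary gf).
exists (g i y); first exact: chain_cocycle.
rewrite -opprB; apply: coboundaryN; exact: (homotopic_coboundary fg).
Qed.

End Homotopy.

Section Shift.
Variables (A : pzRingType) (n : int).
Implicit Types X Y : complex A.

Lemma shift_cocycle X i (x : X (i + n)) : @cocycle A (shift X n) i x <-> cocycle x.
Proof.
split=> hx j; last by rewrite /= /shift_sign hx oppr0 if_same.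
have := hx (j - n); rewrite /= /shift_sign subrK.
by case: ifP => // _ /eqP; rewrite oppr_eq0 => /eqP.
Qed.

Lemma shift_coboundary X i (x : X (i + n)) :
  @coboundary A (shift X n) i x <-> coboundary x.
Proof.
split=> [[j [y <-]] /=|[j [y <-]]]; rewrite /shift_sign.
  case: ifP => _; last by exists (j + n), y.
  by exists (j + n), (- y); rewrite linearN.
(* The sign put on the preimage cancels the sign of the differential of the shift. *)
exists (j - n), (shift_sign n idfun (pcast X j (j - n + n) y)).
rewrite /= /shift_sign; case: (odd _) => /=.
  by rewrite linearN opprK cdiff_pcast ?subrK.
by rewrite cdiff_pcast ?subrK.
Qed.

Lemma shift_acyclic X : acyclic X -> acyclic (shift X n).
Proof. by move=> aX i x /shift_cocycle /aX /shift_coboundary. Qed.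

Definition chain_shift X Y (f : chain_map X Y) : chain_map (shift X n) (shift Y n).
Proof.
exists (fun i => f (i + n) : {linear shift X n i -> shift Y n i}) => i j x /=.
by rewrite /shift_sign; case: ifP => _; rewrite ?linearN chain_comm.
Defined.

Lemma quasi_iso_shift X Y (f : chain_map X Y) : quasi_iso f -> quasi_iso (chain_shift f).
Proof.
move=> qf i; have [inj surj] := qf (i + n); split=> [x cx bx|y cy].
  apply/shift_coboundary/inj; first exact/shift_cocycle.
  exact/shift_coboundary.
have [x cx bx] := surj y (proj1 (shift_cocycle y) cy).
by exists x; [apply/shift_cocycle | apply/shift_coboundary].
Qed.

End Shift.

(** * Lifting along quasi-isomorphisms *)

Section Cone.
Variables (A : pzRingType) (Y Z : complex A) (s : chain_map Y Z).

(** The differential of the mapping cone. As [pcast] vanishes unless [j = i + 1], the term in [s]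
    has the right shape by itself. *)
Definition cone_diff i j (c : Z i * Y (i + 1)%R) : Z j * Y (j + 1)%R :=
  (cdiff Z i j c.1 + s j (pcast Y (i + 1) j c.2), - cdiff Y (i + 1) (j + 1) c.2).

Lemma cone_diff_linear i j : linear (@cone_diff i j).
Proof.
move=> a [z y] [z' y']; rewrite /cone_diff /=; congr pair => /=.
  by rewrite !linearP /= scalerDr addrACA.
by rewrite linearP opprD scalerN.
Qed.

Definition cone : complex A.
Proof.
exists (fun i => (Z i * Y (i + 1)%R)%type : lmodType A)
       (fun i j => mk_linear (@cone_diff_linear i j)).
  move=> i j ne [z y]; rewrite /= /cone_diff /= cdiff_shape // pcast0; last first.
    by move=> e; apply: ne.
  rewrite linear0 addr0 cdiff_shape ?oppr0 // => e; apply: ne.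
  exact: (addIr 1).
move=> i j k [z y]; rewrite /= /cone_diff /= linearD cdiffK add0r.
rewrite !(linearN, cdiffK) ?opprK /=; congr pair.
have [e|/eqP ne] := eqVneq (i + 1) j.
  case: _ / e; rewrite pcast_id -chain_comm.
  have [e'|/eqP ne'] := eqVneq (i + 1 + 1) k.
    by case: _ / e'; rewrite pcast_id subrr.
  by rewrite pcast0 // linear0 subr0 cdiff_shape ?linear0 // => e; apply: ne'.
rewrite pcast0 // !linear0 add0r cdiff_shape ?linear0 ?oppr0 //.
by move/addIr => e; apply: ne.
Defined.

(** A cocycle [(z, y)] satisfies [s y = - d z], so injectivity on cohomology gives [y = d y']. Then
    [z + s y'] is a cocycle, equal to [s x0 + d z0] by surjectivity, and [(z0, x0 - y')] is a
    preimage. *)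
Lemma cone_acyclic : quasi_iso s -> acyclic cone.
Proof.
move=> qs i [z y] cx.
have [inj surj] := qs (i + 1).
have /(congr1 fst) /= := cx (i + 1); rewrite /cone_diff /= pcast_id => dz.
have cy : cocycle y.
  apply: (@cocycleP _ _ _ (i + 1 + 1)) => //.
  by have /(congr1 snd) /= /eqP := cx (i + 1); rewrite oppr_eq0 => /eqP.
have [|y' dy'] := @coboundaryP _ _ _ y i erefl.
  apply: inj => //; exists i, (- z); rewrite linearN.
  by apply/esym/eqP; rewrite -addr_eq0 -dz; apply/eqP/addrC.
have [_ surj'] := qs i.
have [|x0 cx0 bx0] := surj' (z + s i y').
  apply: (@cocycleP _ _ _ (i + 1)) => //.
  by rewrite linearD /= -chain_comm dy'.
have [|z0 dz0] := @coboundaryP _ _ _ _ (i - 1) _ bx0; first by rewrite subrK.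
exists (i - 1), (z0, pcast Y i (i - 1 + 1) (x0 - y')).
rewrite /= /cone_diff /= dz0 pcast_trans ?subrK // pcast_id.
by rewrite !linearB /= subrKA addrK cx0 dy' oppr0 sub0r opprK.
Qed.

End Cone.

Section Lifting.
Variables (A : pzRingType) (P Y Z : complex A) (s : chain_map Y Z).
Hypotheses (KP : K_projective P) (qs : quasi_iso s).

Section Existence.
Variable f : chain_map P Z.

Definition to_cone_fun i (x : P i) : cone s i := (f i x, 0).

Lemma to_cone_linear i : linear (@to_cone_fun i).
Proof.
move=> a x y; rewrite /to_cone_fun linearP; congr pair.
by rewrite /= scaler0 addr0.
Qed.

Definition to_cone : chain_map P (cone s).
Proof.
exists (fun i => mk_linear (@to_cone_linear i)) => i j x /=.
by rewrite /to_cone_fun /cone_diff /= !linear0 addr0 chain_comm.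
Defined.

(* A null homotopy of [P -> Z -> cone s] splits into a map [P -> Y] and a
   homotopy in [Z]. *)
Lemma lift_exists : exists g : chain_map P Y, homotopic (chain_comp s g) f.
Proof.
have [h hP] := KP to_cone (cone_acyclic qs).
pose h1 i j x : Z j := (h i j x).1.
pose h2 i j x : Y (j + 1) := (h i j x).2.
have h1l i j : linear (@h1 i j) by move=> a x y; rewrite /h1 linearP.
have h2l i j : linear (@h2 i j) by move=> a x y; rewrite /h2 linearP.
have e1 i x : f i x = cdiff Z (i - 1) i (h1 i (i - 1) x)
    + s i (pcast Y (i - 1 + 1) i (h2 i (i - 1) x)) + h1 (i + 1) i (cdiff P i (i + 1) x).
  by have := congr1 fst (hP i x); rewrite /= subr0.
have e2 i x : cdiff Y (i - 1 + 1) (i + 1) (h2 i (i - 1) x)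
    = h2 (i + 1) i (cdiff P i (i + 1) x).
  have := congr1 snd (hP i x); rewrite /= subr0 => /eqP.
  by rewrite eq_sym addr_eq0 eqr_opp => /eqP.
pose g i : {linear P i -> Y i} := pcast Y (i - 1 + 1) i \o mk_linear (h2l i (i - 1)).
have gP i j x : g j (cdiff P i j x) = cdiff Y i j (g i x).
  have [e|/eqP ne] := eqVneq j (i + 1); last by rewrite !cdiff_shape ?linear0.
  rewrite e /g /= cdiff_pcast ?subrK // e2.
  (* Generalizing the degree allows [i + 1 - 1] to be replaced by [i] under dependent types. *)
  have : forall k, k = i -> pcast Y (k + 1) (i + 1) (h2 (i + 1) k (cdiff P i (i + 1) x))
      = h2 (i + 1) i (cdiff P i (i + 1) x) by move=> k ->; rewrite pcast_id.
  by apply; rewrite addrK.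
exists (ChainMap gP); apply: homotopic_sym.
exists (fun i j => mk_linear (h1l i j)) => i x /=.
by rewrite e1 addrAC addrK.
Qed.

End Existence.

Section Uniqueness.
Variable g : chain_map P Y.
Variable k : forall i j, {linear P i -> Z j}.
Hypothesis kP : forall i x, s i (g i x) =
  cdiff Z (i - 1) i (k i (i - 1) x) + k (i + 1) i (cdiff P i (i + 1) x).

(** The lift of [g] to the fibre [cone s [-1]] determined by the null homotopy [k] of [s g]. *)
Definition to_shifted_cone_fun i (x : P i) : shift (cone s) (- 1) i :=
  (k i (i - 1) x, - pcast Y i (i - 1 + 1) (g i x)).

Lemma to_shifted_cone_linear i : linear (@to_shifted_cone_fun i).
Proof.
by move=> a x y; rewrite /to_shifted_cone_fun !linearP.
Qed.

Definition to_shifted_cone : chain_map P (shift (cone s) (- 1)).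
Proof.
exists (fun i => mk_linear (@to_shifted_cone_linear i)) => i j x.
have [->|/eqP ne] := eqVneq j (i + 1); last by rewrite !cdiff_shape ?linear0.
rewrite /= /shift_sign /= /to_shifted_cone_fun /cone_diff /=; congr pair.
  have /(_ _ (addrK _ _)) h : forall j, j = i -> k (i + 1) j (cdiff P i (i + 1) x) =
      - (cdiff Z (i - 1) j (k i (i - 1) x) +
         s j (pcast Y (i - 1 + 1) j (- pcast Y i (i - 1 + 1) (g i x)))).
    move=> _ ->; rewrite !linearN pcast_trans ?subrK // pcast_id kP opprD opprK.
    by rewrite addrA addNr add0r.
  exact: h.
by rewrite /= linearN opprK linearN cdiff_pcast ?subrK // chain_comm pcast_cdiff ?addrK.
Defined.

End Uniqueness.

(** The fibre [cone s [-1]] is acyclic, so K-projectivity contracts the lift of [g] to it; up to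
    sign, the [Y]-component of this contraction contracts [g]. *)
Lemma lift_null (g : chain_map P Y) :
  homotopic (chain_comp s g) (chain_zero P Z) -> homotopic g (chain_zero P Y).
Proof.
move=> [k kP].
have kP' i x : s i (g i x) =
  cdiff Z (i - 1) i (k i (i - 1) x) + k (i + 1) i (cdiff P i (i + 1) x).
  by have := kP i x; rewrite /= subr0.
have [h hP] := KP (to_shifted_cone kP') (shift_acyclic (cone_acyclic qs)).
pose h2 i j x : Y j := - pcast Y (j - 1 + 1) j (h i j x).2.
have h2l i j : linear (@h2 i j).
  by move=> a x y; rewrite /h2 linearP /= !linearP.
exists (fun i j => mk_linear (h2l i j)) => i x /=.
have /(congr1 (fun u => - pcast Y (i - 1 + 1) i u)) := congr1 snd (hP i x).
rewrite /= !subr0 linearN opprK pcast_trans ?subrK // pcast_id => ->.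
rewrite /h2 linearD opprD; congr (_ - _).
by rewrite opprK [RHS]linearN pcast_cdiff ?subrK // cdiff_pcast ?subrK.
Qed.

End Lifting.

(** * K-projectivity of strictly perfect complexes *)

Section ProjectiveModules.
Variable A : pzRingType.

(** The [c k] are the coordinates of a splitting of the surjection from [A^n] defined by the
    generators. *)
Lemma dual_basis (M : lmodType A) : fin_gen M -> projective M ->
  exists n (g : 'I_n -> M) (c : 'I_n -> {linear M -> A^o}),
    forall x, x = \sum_k (c k x : A) *: g k.
Proof.
move=> [n [g gP]] projM.
pose p (u : {ffun 'I_n -> A^o}) := \sum_k (u k : A) *: g k.
have pl : linear p.
  move=> a u v; rewrite /p scaler_sumr -big_split /=; apply: eq_bigr => k _.
  by rewrite !ffunE scalerDl scalerA.
have [|s sP] := projM _ _ (mk_linear pl) idfun.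
  move=> y; have [c ->] := gP y; exists [ffun k => c k : A^o].
  by rewrite /= /p; apply: eq_bigr => k _; rewrite ffunE.
pose c k (x : M) : A^o := s x k.
have cl k : linear (c k) by move=> a x y; rewrite /c linearP !ffunE.
exists n, g, (fun k => mk_linear (cl k)) => x /=.
by rewrite -[LHS]/(idfun x) -sP.
Qed.

Variable P : complex A.

(** The null homotopy is built by descending induction. Once its equation holds above degree [i0],
    the defect [f - h d] in degree [i0] takes values in cocycles, hence in coboundaries, and lifts
    through the differential along a dual basis. *)
Lemma strictly_perfect_K_projective : strictly_perfect P -> K_projective P.
Proof.
move=> [projP [n nP]] Z f aZ.
pose good (h : forall i j, {linear P i -> Z j}) i := forall x,
  f i x = cdiff Z (i - 1) i (h i (i - 1) x) + h (i + 1) i (cdiff P i (i + 1) x).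
suff H (k : nat) : exists h, forall i, n - k%:Z < i -> good h i.
  (* After [2|n| + 1] steps only degrees below [- |n|] remain, where [P] vanishes again. *)
  have [h hP] := H (`|n| + `|n| + 1)%N.
  exists h => i x; rewrite /= subr0.
  have [lt_i|ge_i] := ltP (n - (`|n| + `|n| + 1)%N%:Z) i; first exact: hP.
  have -> : x = 0 by apply: (nP i); lia.
  by rewrite !linear0 addr0.
elim: k => [|k [h hP]].
  exists (fun i j => \0) => i lt_i x.
  have -> : x = 0 by apply: (nP i); lia.
  by rewrite !linear0 addr0.
pose i0 : int := n - k%:Z.
have [m [g [c cP]]] := dual_basis (proj1 (projP i0)) (proj2 (projP i0)).
pose u x := f i0 x - h (i0 + 1) i0 (cdiff P i0 (i0 + 1) x).
have [y yP] : exists y : 'I_m -> Z (i0 - 1), forall k, cdiff Z (i0 - 1) i0 (y k) = u (g k).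
  apply: (fin_all_exists (P := fun l z => cdiff Z (i0 - 1) i0 z = u (g l))) => l.
  apply: coboundaryP; first by rewrite subrK.
  apply: aZ; apply: (@cocycleP _ _ _ (i0 + 1)) => //.
  rewrite /u linearB /= -chain_comm hP; last by rewrite /i0; lia.
  rewrite cdiffK linear0 addr0; apply/eqP; rewrite subr_eq0; apply/eqP.
  have : forall j, j = i0 ->
     cdiff Z j (i0 + 1) (h (i0 + 1) j (cdiff P i0 (i0 + 1) (g l))) =
     cdiff Z i0 (i0 + 1) (h (i0 + 1) i0 (cdiff P i0 (i0 + 1) (g l))) by move=> j ->.
  by apply; rewrite addrK.
pose v (x : P i0) := \sum_k (c k x : A) *: y k : Z (i0 - 1).
have vl : linear v.
  move=> a x x'; rewrite /v scaler_sumr -big_split /=; apply: eq_bigr => l _.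
  by rewrite linearP scalerDl scalerA.
have ul : linear u.
  by move=> a x x'; rewrite /u !linearP scalerDr addrACA.
have dv x : cdiff Z (i0 - 1) i0 (v x) = u x.
  rewrite [in RHS](cP x) -[RHS]/(mk_linear ul _) !linear_sum /=.
  apply: eq_bigr => l _.
  by rewrite linearZ yP -[RHS]/(mk_linear ul _) linearZ.
(* Only the components out of degree [i0] change; the equation in a degree [i > i0] involves those
   out of [i] and [i + 1]. *)
exists (fun i j => if i == i0
    then pcast Z (i0 - 1) j \o mk_linear vl \o pcast P i i0 : {linear P i -> Z j}
    else h i j) => i lt_i x.
have -> : (i + 1 == i0) = false by apply/eqP; rewrite /i0; lia.
have [e|/eqP ne] := eqVneq i i0; last by apply: hP; rewrite /i0 in ne; lia.
case: _ / (esym e) x => x /=.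
by rewrite !pcast_id dv /u subrK.
Qed.

End ProjectiveModules.

Section ChainMaps.
Variable A : pzRingType.
Implicit Types X Y Z P : complex A.

Definition chain_sub X Y (f g : chain_map X Y) : chain_map X Y.
Proof.
exists (fun i => (f i \- g i) : {linear X i -> Y i}) => i j x /=.
by rewrite !chain_comm linearB.
Defined.

Lemma homotopic_sub X Y (f g : chain_map X Y) :
  homotopic (chain_sub f g) (chain_zero X Y) <-> homotopic f g.
Proof. by split=> -[h hP]; exists h => i x; rewrite -hP /= subr0. Qed.

Lemma lift_unique P Y Z (s : chain_map Y Z) (g g' : chain_map P Y) :
  K_projective P -> quasi_iso s ->
  homotopic (chain_comp s g) (chain_comp s g') -> homotopic g g'.
Proof.
move=> KP qs hs; apply/homotopic_sub/(lift_null KP qs).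
apply: (@homotopic_trans _ _ _ _ (chain_sub (chain_comp s g) (chain_comp s g'))).
  by apply: homotopic_ext => i x /=; rewrite linearB.
exact/homotopic_sub.
Qed.

End ChainMaps.

(** * Morphisms of the derived category *)

Section Roofs.
Variables (A : pzRingType) (P X Y : complex A) (p : chain_map P X).
Hypotheses (KP : K_projective P) (qp : quasi_iso p).

(* [g] is the image of the roof [a] in Hom_K(P, Y) = Hom_D(X, Y). *)
Definition represents (a : roof X Y) (g : chain_map P Y) :=
  exists w : chain_map P (apex a),
    homotopic (chain_comp (den a) w) p /\ homotopic (chain_comp (num a) w) g.

Lemma represents_exists a : exists g, represents a g.
Proof.
have [w wP] := lift_exists KP (den_quasi_iso a) p.
by exists (chain_comp (num a) w), w; split=> //; apply: homotopic_refl.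
Qed.

Lemma represents_homotopic a g g' : represents a g -> homotopic g g' -> represents a g'.
Proof. by move=> [w [h h']] e; exists w; split=> //; apply: homotopic_trans e. Qed.

Lemma represents_unique a g g' : represents a g -> represents a g' -> homotopic g g'.
Proof.
move=> [w [h1 h2]] [w' [h1' h2']].
have e : homotopic w w'.
  apply: (lift_unique KP (den_quasi_iso a)).
  exact: homotopic_trans (homotopic_sym h1').
apply: homotopic_trans (homotopic_sym h2) _.
by apply: homotopic_trans h2'; apply: homotopic_compl.
Qed.

Lemma represents_roof Z (s : chain_map Z X) (qs : quasi_iso s) (f : chain_map Z Y) w :
  homotopic (chain_comp s w) p -> represents (Roof qs f) (chain_comp f w).
Proof. by move=> h; exists w; split=> //; apply: homotopic_refl. Qed.

Lemma represents_num g : represents (Roof qp g) g.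
Proof. by exists (chain_id P); split; apply: homotopic_ext. Qed.

Lemma represents_zero : represents (roof_zero X Y) (chain_zero P Y).
Proof. by exists p; split; apply: homotopic_ext. Qed.

Lemma represents_roof_eq a b g : roof_eq a b -> represents a g -> represents b g.
Proof.
move=> [W [u [v [qu huv hn]]]] [w [h1 h2]].
have [w' w'P] := lift_exists KP qu p.
have e : homotopic (chain_comp u w') w.
  apply: (lift_unique KP (den_quasi_iso a)).
  exact: homotopic_trans (homotopic_sym h1).
exists (chain_comp v w'); split.
  apply: homotopic_trans w'P; apply: homotopic_sym.
  exact: (homotopic_compr w' huv).
apply: (homotopic_trans _ h2).
apply: (@homotopic_trans _ _ _ _ (chain_comp (num a) (chain_comp u w'))).
  exact/homotopic_sym/(homotopic_compr w' hn).
exact: homotopic_compl.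
Qed.

(** [P], with its two lifts to the apices, is itself a common refinement of the roofs. *)
Lemma roof_eqP a b g : represents a g -> represents b g -> roof_eq a b.
Proof.
move=> [w [h1 h2]] [w' [h1' h2']]; exists P, w, w'; split.
- exact: (quasi_iso_homotopic (homotopic_sym h1)).
- exact: homotopic_trans (homotopic_sym h1').
- exact: homotopic_trans (homotopic_sym h2').
Qed.

(** Replacing the target by a quasi-isomorphic [Y'] lets one resolution serve for both arguments of
    Hom. *)
Lemma derived_Hom_zeroP Y' (q : chain_map Y' Y) : quasi_iso q ->
  derived_Hom_zero X Y <-> forall f : chain_map P Y', homotopic f (chain_zero P Y').
Proof.
move=> qq; split=> [H f|H a].
  apply: (lift_null KP qq).
  have := represents_roof_eq (H _) (represents_num (chain_comp q f)).
  by move/represents_unique; apply; apply: represents_zero.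
have [g ag] := represents_exists a; apply: (roof_eqP ag).
have [g' g'P] := lift_exists KP qq g.
apply: represents_homotopic represents_zero _.
apply: homotopic_trans g'P; apply: homotopic_sym.
apply: homotopic_trans (homotopic_compl q (H g')) _.
by apply: homotopic_ext => i x /=; rewrite linear0.
Qed.

End Roofs.

Section FreeHom.
Variables (R : comNzRingType) (L : ralgebra R).
Implicit Types X Y Z P T : complex (L : pzRingType)^c.

Lemma central_scale (M : lmodType (L : pzRingType)^c) (r : R) (a : (L : pzRingType)^c) (x : M) :
  (alg_map L r : (L : pzRingType)^c) *: (a *: x) = a *: ((alg_map L r : (L : pzRingType)^c) *: x).
Proof.
rewrite !scalerA; congr (_ *: _).
exact: esym (alg_central r (a : L)).
Qed.

Definition is_lincomb X Y n (r : 'I_n -> R) (f : 'I_n -> chain_map X Y) (g : chain_map X Y) :=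
  forall i x, g i x = \sum_k (alg_map L (r k) : L^c) *: f k i x.

Lemma lincomb_linear (M N : lmodType (L : pzRingType)^c) n (r : 'I_n -> R)
    (f : 'I_n -> {linear M -> N}) :
  linear (fun x => \sum_k (alg_map L (r k) : (L : pzRingType)^c) *: f k x).
Proof.
move=> a x y; rewrite scaler_sumr -big_split /=; apply: eq_bigr => k _.
by rewrite linearP scalerDr central_scale.
Qed.

Lemma lincomb_exists X Y n (r : 'I_n -> R) (f : 'I_n -> chain_map X Y) :
  exists g, is_lincomb r f g.
Proof.
unshelve eexists.
  exists (fun i => mk_linear (lincomb_linear r (fun k => f k i))) => i j x /=.
  rewrite linear_sum; apply: eq_bigr => k _.
  by rewrite linearZ chain_comm.
by [].
Qed.

Lemma homotopic_lincomb X Y n (r : 'I_n -> R) (f f' : 'I_n -> chain_map X Y) g g' :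
  is_lincomb r f g -> is_lincomb r f' g' ->
  (forall k, homotopic (f k) (f' k)) -> homotopic g g'.
Proof.
move=> gP gP' /fin_all_exists [h hP].
exists (fun i j => mk_linear (lincomb_linear r (fun k => h k i j))) => i x /=.
rewrite gP gP' -sumrB linear_sum -big_split /=; apply: eq_bigr => k _.
by rewrite -scalerBr hP scalerDr linearZ.
Qed.

(** Freeness over [R] of the module of homotopy classes of endomorphisms of [P], stated on
    representatives. *)
Definition homotopy_free P := exists (I : Type) (e : I -> chain_map P P),
  (forall f, exists n (k : 'I_n -> I) (r : 'I_n -> R) g,
     is_lincomb r (fun l => e (k l)) g /\ homotopic f g) /\
  (forall n (k : 'I_n -> I) (r : 'I_n -> R) g, injective k ->
     is_lincomb r (fun l => e (k l)) g -> homotopic g (chain_zero P P) ->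
     forall l, r l = 0).

Variables (P T : complex (L : pzRingType)^c) (p : chain_map P T).
Hypotheses (KP : K_projective P) (qp : quasi_iso p).

(** [derived_lincomb] involves an unspecified common denominator [s]. Lifting [p] through [s]
    carries the numerators to chain maps out of [P], where the combination is independent of [s]. *)
Lemma represents_lincomb n (r : 'I_n -> R) a c (f : 'I_n -> chain_map P T) g :
  derived_lincomb r a c -> (forall k, represents p (a k) (f k)) ->
  is_lincomb r f g -> represents p c g.
Proof.
move=> [Z [s [qs [f' [g' [aP g'P cP]]]]]] rf gP.
have [w wP] := lift_exists KP qs p.
have rg : represents p c (chain_comp g' w).
  have [c' cr] := represents_exists p KP c.
  apply: (represents_homotopic cr).
  apply: (represents_unique KP (represents_roof_eq KP cP cr)).
  exact: represents_roof.
apply: (represents_homotopic rg).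
apply: (@homotopic_lincomb _ _ _ r (fun k => chain_comp (f' k) w) f) => //.
  by move=> i x; rewrite /= g'P.
move=> k; apply: (represents_unique KP _ (represents_roof_eq KP (aP k) (rf k))).
exact: represents_roof.
Qed.

Lemma lincomb_represents n (r : 'I_n -> R) a c (f : 'I_n -> chain_map P T) g :
  (forall k, represents p (a k) (f k)) -> represents p c g ->
  is_lincomb r f g -> derived_lincomb r a c.
Proof.
move=> af cg gP; exists P, p, qp, f, g; split=> //.
  by move=> k; apply: (roof_eqP qp (af k)) => //; apply: represents_num.
by apply: (roof_eqP qp cg) => //; apply: represents_num.
Qed.

(** Composition with [p] is an R-linear bijection from homotopy classes [P -> P] to homotopy classes
    [P -> T], so bases can be transported along it. *)
Lemma derived_Hom_freeP : derived_Hom_free T T <-> homotopy_free P.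
Proof.
split=> [[I [e [gen ind]]]|[I [e [gen ind]]]].
  have : forall i, exists f : chain_map P P, represents p (e i) (chain_comp p f).
    move=> i; have [g gP] := represents_exists p KP (e i).
    have [f fP] := lift_exists KP qp g; exists f.
    by apply: (represents_homotopic gP); apply: homotopic_sym.
  move/choice=> [phi phiP]; exists I, phi; split=> [f|n k r g k_inj gP g0].
    have [n [k [r lP]]] := gen (Roof qp (chain_comp p f)).
    have [g gP] := lincomb_exists r (fun l => phi (k l)).
    exists n, k, r, g; split=> //; apply: (lift_unique KP qp).
    apply: (represents_unique KP (represents_num qp _)).
    apply: (represents_lincomb lP (fun l => phiP (k l))) => i x /=.
    by rewrite gP linear_sum; apply: eq_bigr => l _; rewrite linearZ.
  apply: (ind _ k) => //.
  apply: (lincomb_represents (fun l => phiP (k l)) (g := chain_comp p g)).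
    apply: (represents_homotopic (represents_zero _ _)).
    apply: homotopic_sym; apply: homotopic_trans (homotopic_compl p g0) _.
    by apply: homotopic_ext => i x /=; rewrite linear0.
  by move=> i x /=; rewrite gP linear_sum; apply: eq_bigr => l _; rewrite linearZ.
exists I, (fun i => Roof qp (chain_comp p (e i))); split=> [c|n k r k_inj lP].
  have [g cg] := represents_exists p KP c.
  have [f fP] := lift_exists KP qp g.
  have [n [k [r [g' [g'P fg']]]]] := gen f.
  exists n, k, r.
  apply: (lincomb_represents (fun l => represents_num qp _) (g := chain_comp p g')).
    apply: (represents_homotopic cg); apply: homotopic_trans (homotopic_sym fP) _.
    exact: homotopic_compl.
  by move=> i x /=; rewrite g'P linear_sum; apply: eq_bigr => l _; rewrite linearZ.
have [g gP] := lincomb_exists r (fun l => e (k l)).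
apply: (ind _ k r g) => //; apply: (lift_unique KP qp).
have := represents_lincomb lP (fun l => represents_num qp _) (g := chain_comp p g).
have gP' : is_lincomb r (fun l => chain_comp p (e (k l))) (chain_comp p g).
  by move=> i x /=; rewrite gP linear_sum; apply: eq_bigr => l _; rewrite linearZ.
move=> /(_ gP')/(represents_unique KP)/(_ (represents_zero _ _)) h.
apply: homotopic_trans h _.
by apply: homotopic_ext => i x /=; rewrite linear0.
Qed.

End FreeHom.

(** * Extension of scalars *)

Section RestrictionOfScalars.
Variables (A B : pzRingType) (pi : {rmorphism A -> B}).

(** The morphism is part of the type, so that the action of [A^c] can be inferred from it. *)
Definition restr of {rmorphism A -> B} := fun N : lmodType B^c => N : Type.

Section Module.
Variable N : lmodType B^c.

HB.instance Definition _ := GRing.Zmodule.copy (restr pi N) N.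

Definition restr_scale (a : A^c) (x : restr pi N) : restr pi N :=
  (pi a : B^c) *: (x : N).

Lemma restr_scaleA a b x : restr_scale a (restr_scale b x) = restr_scale (a * b) x.
Proof. by rewrite /restr_scale scalerA; congr (_ *: _); rewrite (rmorphM pi b a). Qed.

Lemma restr_scale1 : left_id 1 restr_scale.
Proof. by move=> x; rewrite /restr_scale (rmorph1 pi) scale1r. Qed.

Lemma restr_scaleDr : right_distributive restr_scale +%R.
Proof. by move=> a x y; rewrite /restr_scale scalerDr. Qed.

Lemma restr_scaleDl x : {morph restr_scale^~ x : a b / a + b}.
Proof. by move=> a b; rewrite /restr_scale (rmorphD pi a b) scalerDl. Qed.

HB.instance Definition _ := GRing.Zmodule_isLmodule.Build A^c (restr pi N)
  restr_scaleA restr_scale1 restr_scaleDr restr_scaleDl.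

End Module.

Lemma restr_linear (M N : lmodType B^c) (f : {linear M -> N}) :
  linear (f : restr pi M -> restr pi N).
Proof. by move=> a x y; apply: (linearP f (pi a : B^c)). Qed.

Definition restr_complex (Z : complex B^c) : complex A^c.
Proof.
exists (fun i => restr pi (Z i)) (fun i j => mk_linear (restr_linear (cdiff Z i j))).
  by move=> i j ne x; apply: cdiff_shape.
by move=> i j k x; apply: cdiffK.
Defined.

Lemma restr_acyclic Z : acyclic Z -> acyclic (restr_complex Z).
Proof. by move=> aZ i x cx; have [j [y yP]] := aZ i x cx; exists j, y. Qed.

End RestrictionOfScalars.

Section Tensor.
Local Open Scope quotient_scope.
Variables (A B : pzRingType) (pi : {rmorphism A -> B}).
Implicit Types M N : lmodType A^c.

(** The unit of the adjunction between extension and restriction of scalars. *)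
Definition tens M (x : M) : restr pi (tensorB pi M) := \pi_(tensorB pi M) [:: (x, 1)].

Lemma tens_pure M (x : M) b :
  \pi_(tensorB pi M) [:: (x, b)] = (b : B^c) *: (tens x : tensorB pi M).
Proof. by rewrite -[RHS]tensorB_piZ /= mul1r. Qed.

Lemma tens_linear M : linear (@tens M).
Proof.
move=> a x y; rewrite -[RHS]/(((pi a : B^c) *: (tens x : tensorB pi M)) + (tens y : tensorB pi M)).
rewrite -tens_pure -[RHS]tensorB_piD /=; apply/tensorBP.
apply: trel_trans (trel_addl _ _ _ _) _.
apply: (@trel_cat _ _ _ _ [:: _] [:: _] [:: _] [:: _]); last exact: trel_refl.
by have := trel_bal pi x a 1; rewrite mulr1.
Qed.

HB.instance Definition _ M :=
  GRing.isLinear.Build A^c M (restr pi (tensorB pi M)) *:%R (@tens M) (@tens_linear M).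

Lemma tensB_ind M (Q : tensorB pi M -> Prop) :
  Q 0 -> (forall x b u, Q u -> Q ((b : B^c) *: (tens x : tensorB pi M) + u)) -> forall u, Q u.
Proof.
move=> Q0 QS u; rewrite -[u]reprK; elim: (repr u) => [|[x b] w ih]; first exact: Q0.
rewrite -[_ :: _]/([:: (x, b)] ++ w) tensorB_piD tens_pure.
exact: QS.
Qed.

Lemma tens_ext M (N : lmodType B^c) (f g : {linear tensorB pi M -> N}) :
  (forall x : M, f (tens x) = g (tens x)) -> forall u, f u = g u.
Proof.
move=> e; apply: tensB_ind; first by rewrite !linear0.
by move=> x b u ih; rewrite !linearD !linearZ ih e.
Qed.

Lemma tensorB_map_tens M N (f : {linear M -> N}) x :
  tensorB_map pi f (tens x) = tens (f x).
Proof. exact: tensorB_piM. Qed.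

Section Universal.
Variables (M : lmodType A^c) (N : lmodType B^c) (f : {linear M -> restr pi N}).

(** The adjoint transpose of [f], computed on words before passing to the quotient. *)
Definition word_eval (w : tword B M) : N := \sum_(p <- w) (p.2 : B^c) *: (f p.1 : N).

Lemma word_eval_trel w w' : trel pi w w' -> word_eval w = word_eval w'.
Proof.
rewrite /word_eval.
elim=> {w w'} [w|w w' _ ->|w' w w'' _ h _|w1 w1' w2 w2' _ h1 _ h2|w w'|b|x y b|x b d|x a b] //.
- by move=> h'; rewrite h.
- by rewrite !big_cat h1 h2.
- by rewrite !big_cat /= addrC.
- by rewrite big_seq1 big_nil linear0 scaler0.
- by rewrite !big_cons !big_nil !addr0 /= linearD scalerDr.
- by rewrite !big_cons !big_nil !addr0 /= -scalerDl.
- rewrite !big_seq1 /= linearZ -[X in _ *: X]/((pi a : B^c) *: (f x : N)).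
  by rewrite scalerA.
Qed.

Definition tensor_lift_fun (u : tensorB pi M) : N := word_eval (repr u).

Lemma tensor_lift_pi w : tensor_lift_fun (\pi_(tensorB pi M) w) = word_eval w.
Proof. exact/word_eval_trel/trel_repr. Qed.

Lemma tensor_lift_linear : linear tensor_lift_fun.
Proof.
move=> c u v; rewrite -[u]reprK -[v]reprK.
rewrite -[_ *: _ + _]/(tensorB_add (tensorB_scale c _) _) -tensorB_piZ -tensorB_piD.
rewrite !tensor_lift_pi /word_eval big_cat big_map scaler_sumr; congr (_ + _).
by apply: eq_bigr => p _; rewrite /= scalerA.
Qed.

Definition tensor_lift : {linear tensorB pi M -> N} := mk_linear tensor_lift_linear.

Lemma tensor_lift_tens x : tensor_lift (tens x) = f x.
Proof. by rewrite /= tensor_lift_pi /word_eval big_seq1 scale1r. Qed.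

End Universal.

Definition extend_map (X Y : complex A^c) (f : chain_map X Y) :
  chain_map (extend_scalars pi X) (extend_scalars pi Y).
Proof.
exists (fun i => tensorB_map pi (f i) : {linear tensorB pi (X i) -> tensorB pi (Y i)}) => i j.
apply: (@tens_ext _ _ (tensorB_map pi (f j) \o tensorB_map pi (cdiff X i j))
  (tensorB_map pi (cdiff Y i j) \o tensorB_map pi (f i))) => x /=.
by rewrite !tensorB_map_tens chain_comm.
Defined.

Lemma extend_homotopic (X Y : complex A^c) (f g : chain_map X Y) :
  homotopic f g -> homotopic (extend_map f) (extend_map g).
Proof.
move=> [h hP]; exists (fun i j => tensorB_map pi (h i j)
  : {linear tensorB pi (X i) -> tensorB pi (Y j)}) => i.
apply: (@tens_ext _ _ (tensorB_map pi (f i) \- tensorB_map pi (g i))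
  ((tensorB_map pi (cdiff Y (i - 1) i) \o tensorB_map pi (h i (i - 1))) \+
   (tensorB_map pi (h (i + 1) i) \o tensorB_map pi (cdiff X i (i + 1))))) => x /=.
rewrite !tensorB_map_tens -[LHS]/(tens (f i x) - tens (g i x)).
by rewrite -linearB hP linearD.
Qed.

(** A quasi-isomorphism between K-projective complexes is a homotopy equivalence, and extension of
    scalars preserves homotopies. *)
Lemma extend_quasi_iso (X Y : complex A^c) (f : chain_map X Y) :
  K_projective X -> K_projective Y -> quasi_iso f -> quasi_iso (extend_map f).
Proof.
move=> KX KY qf; have [g gP] := lift_exists KY qf (chain_id Y).
have gf : homotopic (chain_comp g f) (chain_id X).
  apply: (lift_unique KX qf); apply: homotopic_trans (homotopic_compr f gP) _.
  exact: homotopic_ext.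
have ext_comp (X' Y' : complex A^c) (u : chain_map X' Y') (v : chain_map Y' X') :
    homotopic (chain_comp v u) (chain_id X') ->
    homotopic (chain_comp (extend_map v) (extend_map u)) (chain_id (extend_scalars pi X')).
  move=> /extend_homotopic h; apply: homotopic_trans (homotopic_trans h _);
    apply: homotopic_ext => i.
    apply: (@tens_ext _ _ (tensorB_map pi (v i) \o tensorB_map pi (u i))
      (tensorB_map pi (chain_comp v u i))) => x /=.
    by rewrite !tensorB_map_tens.
  apply: (@tens_ext _ _ (tensorB_map pi (chain_id X' i)) idfun) => x /=.
  by rewrite tensorB_map_tens.
by apply: (@homotopy_equiv_quasi_iso _ _ _ _ (extend_map g)); apply: ext_comp.
Qed.

(** By adjunction [f] becomes a chain map from [P] to the restriction of [Z], which is still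
    acyclic; the resulting null homotopy is transposed back. *)
Lemma extend_K_projective (P : complex A^c) :
  K_projective P -> K_projective (extend_scalars pi P).
Proof.
move=> KP Z f aZ.
have fl i : linear ((fun x => f i (tens x)) : P i -> restr pi (Z i)).
  move=> a x y; rewrite linearP.
  exact: (linearP (f i) (pi a : B^c) (tens x) (tens y)).
have fc i j x : mk_linear (fl j) (cdiff P i j x) =
    cdiff (restr_complex pi Z) i j (mk_linear (fl i) x).
  by rewrite /= -tensorB_map_tens; apply: (chain_comm f).
pose f' := @ChainMap _ P (restr_complex pi Z) (fun i => mk_linear (fl i)) fc.
have [h hP] := KP _ f' (restr_acyclic aZ).
exists (fun i j => tensor_lift (h i j : {linear P i -> restr pi (Z j)})) => i u.
rewrite /= subr0; move: u.
apply: (@tens_ext _ _ (f i) ((cdiff Z (i - 1) i \o tensor_lift (h i (i - 1) : {linear P i -> restr pi (Z (i - 1))}))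
  \+ (tensor_lift (h (i + 1) i : {linear P (i + 1) -> restr pi (Z i)}) \o tensorB_map pi (cdiff P i (i + 1))))) => x.
rewrite /= tensorB_map_tens.
have := hP i x; rewrite /= subr0 => ->.
by congr (cdiff Z (i - 1) i _ + _); apply/esym; apply: tensor_lift_tens.
Qed.

Lemma tens_surj M (u : tensorB pi M) : (forall b, exists a, pi a = b) -> exists x, tens x = u.
Proof.
move=> pi_surj; move: u; apply: tensB_ind; first by exists 0; rewrite linear0.
move=> x b _ [y <-]; have [a <-] := pi_surj b.
by exists ((a : A^c) *: x + y); rewrite linearP.
Qed.

(** Surjectivity of [pi] makes [tens] surjective on [N], so projectivity of [M] applies to [f]
    composed with [tens]. *)
Lemma tensor_map_lift M N (f : {linear tensorB pi M -> tensorB pi N}) :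
  projective M -> (forall b, exists a, pi a = b) ->
  exists g : {linear M -> N}, forall x, tens (g x) = f (tens x).
Proof.
move=> projM pi_surj.
have fl : linear ((fun x => f (tens x)) : M -> restr pi (tensorB pi N)).
  move=> a x y; rewrite linearP.
  exact: (linearP f (pi a : B^c) (tens x) (tens y)).
apply: (projM _ _ (@tens N) (mk_linear fl)) => u; exact: tens_surj.
Qed.

End Tensor.

Section Reduction.
Local Open Scope quotient_scope.
Variables (R : comNzRingType) (m : R -> Prop) (L : ralgebra R).
Implicit Types M N : lmodType (L : pzRingType)^c.
Let pi := (@red_map R m L : {rmorphism L -> redL m L}).

Definition in_mM (M : lmodType (L : pzRingType)^c) (x : M) :=
  exists n (a : 'I_n -> R) (y : 'I_n -> M), (forall k, m (a k)) /\
    x = \sum_k (alg_map L (a k) : (L : pzRingType)^c) *: y k.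

Lemma in_mM_add M (x y : M) : in_mM x -> in_mM y -> in_mM (x + y).
Proof.
move=> [n [a [u [ma ->]]]] [p [b [v [mb ->]]]].
exists (n + p)%N,
  (fun k => match split k with inl i => a i | inr j => b j end),
  (fun k => match split k with inl i => u i | inr j => v j end); split.
  by move=> k; case: (split k).
rewrite big_split_ord /=; congr (_ + _); apply: eq_bigr => k _.
  by rewrite -[lshift p k]/(unsplit (inl k)) unsplitK.
by rewrite -[rshift n k]/(unsplit (inr k)) unsplitK.
Qed.

Lemma in_mM0 M : in_mM (0 : M).
Proof. by exists 0%N, (fun=> 0), (fun=> 0); split=> [[]//|]; rewrite big_ord0. Qed.

Lemma in_mM_linear M N (f : {linear M -> N}) x : in_mM x -> in_mM (f x).
Proof.
move=> [n [a [y [ma ->]]]]; exists n, a, (fun k => f (y k)); split=> //.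
by rewrite linear_sum; apply: eq_bigr => k _; rewrite linearZ.
Qed.

Lemma in_mL_scale M (a : L) (x : M) : in_mL m a -> in_mM ((a : (L : pzRingType)^c) *: x).
Proof.
move=> [n [b [y [mb ->]]]]; exists n, b, (fun k => (y k : (L : pzRingType)^c) *: x).
split=> //; rewrite scaler_suml; apply: eq_bigr => k _.
by rewrite central_scale scalerA.
Qed.

Lemma red_map_surj (b : redL m L) : exists a : L, pi a = b.
Proof. by exists (repr b); apply: reprK. Qed.

(** Together with [tens_surj] this identifies the reduction of [M] with [M / m M]. In the inverse
    map each residue class acts through a chosen representative; the defining relations of the
    tensor product are then respected modulo [m M]. *)
Lemma tens_eq0 (M : lmodType (L : pzRingType)^c) (x : M) : tens pi x = 0 <-> in_mM x.
Proof.
split=> [x0|[n [a [y [ma ->]]]]]; last first.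
  rewrite linear_sum big1 // => k _; rewrite linearZ.
  rewrite -[LHS]/((pi (alg_map L (a k)) : (redL m L : pzRingType)^c) *: (tens pi (y k) : tensorB pi M)).
  suff -> : pi (alg_map L (a k)) = 0 by rewrite scale0r.
  rewrite -(rmorph0 pi); apply/redL_eqP/mLP; rewrite subr0.
  exists 1%N, (fun=> a k), (fun=> 1); split=> //.
  by rewrite big_ord1 mulr1.
pose ev (w : tword (redL m L) M) : M := \sum_(p <- w) (repr p.2 : (L : pzRingType)^c) *: p.1.
have evP w w' : trel pi w w' -> in_mM (ev w - ev w').
  rewrite /ev.
  elim=> {w w'} [w|w w' _|w' w w'' _ h _|w1 w1' w2 w2' _ h1 _ h2|w w'|b|z y b|z b d|z a b].
  - by rewrite subrr; apply: in_mM0.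
  - by move/(in_mM_linear (\- idfun)); rewrite /= opprB.
  - by move=> h'; rewrite -[X in in_mM X](subrKA (ev w')); apply: in_mM_add.
  - by rewrite !big_cat /= opprD addrACA; apply: in_mM_add.
  - by rewrite !big_cat /= [in X in _ - X]addrC subrr; apply: in_mM0.
  - by rewrite big_seq1 big_nil scaler0 subrr; apply: in_mM0.
  - by rewrite !big_cons !big_nil !addr0 /= scalerDr subrr; apply: in_mM0.
  - rewrite !big_cons !big_nil !addr0 /= -scalerDl -scalerBl; apply: in_mL_scale.
    by apply/mLP/redL_eqP; rewrite reprK redL_piD !reprK.
  - rewrite !big_seq1 /= scalerA -scalerBl; apply: in_mL_scale.
    apply/mLP/redL_eqP; rewrite reprK.
    by apply: etrans (redL_piM m a (repr b)) _; rewrite reprK.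
have := x0; rewrite -[0]/(\pi_(tensorB pi M) [::]) => /tensorBP /evP.
rewrite /ev big_seq1 big_nil subr0 /= => h.
(* The chosen representative of 1 may differ from 1, by an element of [m L]. *)
have -> : x = (repr (1 : redL m L) : (L : pzRingType)^c) *: x
             + ((1 - repr (1 : redL m L) : L) : (L : pzRingType)^c) *: x.
  by rewrite -scalerDl addrC subrK scale1r.
apply: in_mM_add => //; apply: in_mL_scale.
by apply/mLP/redL_eqP; rewrite reprK.
Qed.

End Reduction.

(** * Complexes of free modules over a complete local ring *)

Section LocalRing.
Variables (R : comNzRingType) (m : R -> Prop).

Lemma ideal_mul_sum (J : R -> Prop) (T : finType) (a b : T -> R) :
  (forall t, m (a t)) -> (forall t, J (b t)) -> ideal_mul m J (\sum_t a t * b t).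
Proof.
move=> ma Jb; exists #|T|, (a \o enum_val), (b \o enum_val); split=> [k|k|] //=.
exact: (reindex _ (onW_bij _ (enum_val_bij T))).
Qed.

Lemma ideal_expZ (n : nat) x y : is_ideal m -> ideal_exp m n y -> ideal_exp m n (x * y).
Proof.
case: n => [//|n] [_ _ mZ] [p [a [b [ma Jb ->]]]].
exists p, (fun k => x * a k), b; split=> // [k|]; first exact: mZ.
by rewrite mulr_sumr; apply: eq_bigr => k _; rewrite mulrA.
Qed.

(* The inverse of [1 - a], for [a] in [m], is the geometric series. *)
Lemma complete_local_unit x :
  maximal_ideal m -> adically_complete m -> ~ m x -> exists y, y * x = 1.
Proof.
move=> [idm m1 max_m] [sep compl] nmx; have [m0 mD mZ] := idm.
have [[a [b [ma e1]]]|H] := pselect (exists a b, m a /\ 1 = a + b * x); last first.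
  exfalso; apply: nmx.
  (* Otherwise the ideal [m + R x] is proper, so maximality puts [x] into [m]. *)
  apply: (max_m (fun z => exists a b, m a /\ z = a + b * x)).
  - split.
    + by exists 0, 0; rewrite mul0r addr0.
    + move=> _ _ [a [b [ma ->]]] [a' [b' [ma' ->]]]; exists (a + a'), (b + b').
      by split; [exact: mD | rewrite mulrDl addrACA].
    + move=> c _ [a [b [ma ->]]]; exists (c * a), (c * b).
      by split; [exact: mZ | rewrite mulrDr mulrA].
  - by move=> [a [b [ma e1]]]; apply: H; exists a, b.
  - by move=> z mz; exists z, 0; rewrite mul0r addr0.
  - by exists 0, 1; rewrite mul1r add0r.
have powE n : ideal_exp m n (a ^+ n).
  elim: n => [//|n ih] /=; exists 1%N, (fun=> a), (fun=> a ^+ n).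
  by split=> //; rewrite big_ord1 exprS.
have [n|l lP] := compl (fun n => \sum_(i < n) a ^+ i).
  by rewrite big_ord_recr /= addrAC subrr add0r.
exists (l * b); rewrite -mulrA; have -> : b * x = 1 - a by rewrite e1 addrC addKr.
apply/eqP; rewrite -subr_eq0; apply/eqP; apply: sep => n.
(* Both terms on the right lie in the n-th power of [m]. *)
have -> : l * (1 - a) - 1 = (1 - a) * (l - \sum_(i < n) a ^+ i) - a ^+ n.
  have geo : (1 - a) * (\sum_(i < n) a ^+ i) = 1 - a ^+ n.
    by apply: oppr_inj; rewrite -mulNr !opprB -subrX1.
  by rewrite [in RHS]mulrBr geo; ring.
case: n => [//|n].
have idE : ideal_mul m (ideal_exp m n) ((1 - a) * (l - \sum_(i < n.+1) a ^+ i)).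
  exact: (@ideal_expZ n.+1).
have [p [u [v [mu Jv ->]]]] := idE.
rewrite exprS -mulrN.
(* The additional index [None] carries the product of [a] and [- a ^+ n]. *)
have := @ideal_mul_sum (ideal_exp m n) (option 'I_p)
  (fun o => if o is Some k then u k else a) (fun o => if o is Some k then v k else - a ^+ n).
rewrite [X in ideal_mul _ _ X](_ : _ = \sum_(k < p) u k * v k + a * - a ^+ n).
  apply; first by case.
  by case=> //; rewrite -mulN1r; apply: ideal_expZ.
rewrite (bigD1 None) //= addrC; congr (_ + _).
rewrite (reindex_omap Some id) /=; last by case.
by apply: eq_bigl => k; rewrite eqxx.
Qed.

End LocalRing.

Section CommonSupport.
Variables (R : comNzRingType) (V : lmodType R) (B : V -> Prop) (I : Type) (e : I -> V).

(** Generation provides a separate index family, possibly with repetitions, for each element,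
    whereas independence concerns injective families. All indices are collected in one
    duplicate-free list and the coefficients of repeated indices are added. *)
Lemma common_support (T : finType) (w : T -> V) :
  (forall t, exists n (k : 'I_n -> I) (r : 'I_n -> R), B (w t - \sum_l r l *: e (k l))) ->
  exists n (k : 'I_n -> I) (s : T -> 'I_n -> R),
    injective k /\ forall t, B (w t - \sum_l s t l *: e (k l)).
Proof.
move=> wP.
(* [{classic I}] gives the arbitrary index type [I] the decidable equality that [undup] requires. *)
have /fin_all_exists [q qP] : forall t, exists q : seq (R * {classic I}),
    B (w t - \sum_(p <- q) p.1 *: e p.2).
  move=> t; have [n [k [r rP]]] := wP t.
  exists [seq (r l, k l : {classic I}) | l <- enum 'I_n].
  by rewrite big_map /= big_enum.
pose u := undup (flatten [seq [seq p.2 | p <- q t] | t <- enum T]).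
pose k (l : 'I_(size u)) : {classic I} := tnth (in_tuple u) l.
have k_inj : injective k.
  by apply/tuple_uniqP; apply: undup_uniq.
exists (size u), k, (fun t l => \sum_(p <- q t | p.2 == k l) p.1); split=> // t.
rewrite [X in _ - X](_ : _ = \sum_(p <- q t) p.1 *: e p.2); first exact: qP.
under eq_bigr do rewrite scaler_suml.
rewrite (exchange_big_dep xpredT) //= big_seq [RHS]big_seq; apply: eq_bigr => p pq.
have /tnthP [l lP] : p.2 \in in_tuple u.
  rewrite mem_undup; apply/flattenP; exists [seq p.2 | p <- q t]; last exact: map_f.
  by apply: map_f; rewrite mem_enum.
rewrite (bigD1 l) /=; last by rewrite lP.
rewrite big1 ?addr0 => [|i /andP [/eqP pi ni]]; first by rewrite /k -lP.
by case/eqP: ni; apply: k_inj; rewrite -pi lP.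
Qed.

End CommonSupport.

(** * Degree-zero cohomology of a complex of finite projective modules *)

Section Nonpositive.
Variables (R : comNzRingType) (m : R -> Prop) (V : lmodType R).
Variables (G : int -> V -> Prop) (D : int -> {linear V -> V}).

(** A finite dual basis of the submodule [H]; the functionals are defined on the ambient module,
    which avoids subtypes. *)
Definition finite_projective (H : V -> Prop) :=
  exists (T : finType) (e : T -> V) (c : T -> {linear V -> R^o}),
    (forall t, H (e t)) /\ forall x, H x -> x = \sum_t (c t x : R) *: e t.

Definition in_mG n x := exists p (a : 'I_p -> R) (y : 'I_p -> V),
  [/\ forall k, m (a k), forall k, G n (y k) & x = \sum_k a k *: y k].

Definition Z0 x := G 0 x /\ D 0 x = 0.
Definition B0 x := exists2 y, G (- 1) y & D (- 1) y = x.

(** Freeness of the quotient of [Z0] by [B0], stated on representatives. *)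
Definition H0_free := exists (I : Type) (e : I -> V),
  [/\ forall i, Z0 (e i),
      forall z, Z0 z -> exists n (k : 'I_n -> I) (r : 'I_n -> R),
        B0 (z - \sum_l r l *: e (k l)) &
      forall n (k : 'I_n -> I) (r : 'I_n -> R), injective k ->
        B0 (\sum_l r l *: e (k l)) -> forall l, r l = 0].

(* H^{-1} (G / m G) = 0 *)
Definition reduced_exact := forall h, G (- 1) h -> in_mG 0 (D (- 1) h) ->
  exists2 g, G (- 2) g & in_mG (- 1) (h - D (- 2) g).

Hypothesis G_lin : forall n a x y, G n x -> G n y -> G n (a *: x + y).
Hypothesis G_0 : forall n, G n 0.
Hypothesis DG : forall n x, G n x -> G (n + 1) (D n x).
Hypothesis DD : forall n x, G n x -> D (n + 1) (D n x) = 0.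
Hypothesis projG : forall n, finite_projective (G n).
Hypothesis boundedG : exists N : nat, forall n, N%:Z < n -> forall x, G n x -> x = 0.
Hypothesis exact_pos : forall n x, 0 < n -> G n x -> D n x = 0 ->
  exists2 y, G (n - 1) y & D (n - 1) y = x.

Lemma G_sum n (T : finType) (a : T -> R) (y : T -> V) :
  (forall t, G n (y t)) -> G n (\sum_t a t *: y t).
Proof.
move=> Gy; elim/big_rec: _ => [|t x _ Gx]; first exact: G_0.
exact: G_lin.
Qed.

Lemma GB n x y : G n x -> G n y -> G n (x - y).
Proof. by move=> Gx Gy; rewrite addrC -scaleN1r; apply: G_lin. Qed.

(* Descending induction from the bound: the cocycles in degree [n] are a direct
   summand of [G n], so [G (n - 1)] surjects onto a projective module. *)
Lemma differential_section n : 0 < n -> exists s : {linear V -> V},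
  (forall x, G n x -> G (n - 1) (s x)) /\
  (forall z, G n z -> D n z = 0 -> D (n - 1) (s z) = z).
Proof.
have [N NP] := boundedG.
suff H k : forall n, 0 < n -> N%:Z - k%:Z < n -> exists s : {linear V -> V},
    (forall x, G n x -> G (n - 1) (s x)) /\
    (forall z, G n z -> D n z = 0 -> D (n - 1) (s z) = z).
  by move=> n_gt0; apply: (H N) => //; lia.
elim: k => [|k ih] {}n n_gt0 n_gt.
  exists (\0 : {linear V -> V}); split=> [x _|z Gz _]; first exact: G_0.
  by rewrite (NP n _ z Gz) ?linear0 //; lia.
have [||s [sG sP]] := ih (n + 1); [by lia | by lia | rewrite addrK in sG sP].
have [T [e [c [Ge eP]]]] := projG n.
(* [id - s D] projects [G n] onto its cocycles, which are coboundaries by exactness. Preimages of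
   its values on the dual basis define the section. *)
have /fin_all_exists2 [y yG yP] : forall t, exists2 y, G (n - 1) y &
    D (n - 1) y = e t - s (D n (e t)).
  move=> t; apply: exact_pos => //.
    by apply: GB => //; apply/sG/DG.
  by rewrite linearB /= sP ?DD ?subrr //; apply: DG.
pose sg (x : V) : V := \sum_t (c t x : R) *: y t.
have sgl : linear sg.
  move=> a x x'; rewrite /sg scaler_sumr -big_split /=; apply: eq_bigr => t _.
  by rewrite linearP scalerDl scalerA.
exists (mk_linear sgl); split=> [x Gx|z Gz Dz0] /=; first exact: G_sum.
pose rho := (idfun \- (s \o D n)) : {linear V -> V}.
transitivity (rho z); last by rewrite /= Dz0 linear0 subr0.
rewrite [in RHS](eP z Gz) !linear_sum; apply: eq_bigr => t _.
by rewrite !linearZ yP.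
Qed.

(** The retraction is [id - s D], where [s] is a section of the differential over the cocycles of
    degree 1. *)
Lemma cocycle_retraction : exists rho : {linear V -> V},
  (forall x, G 0 x -> Z0 (rho x)) /\ (forall z, Z0 z -> rho z = z).
Proof.
have [//|s [sG sP]] := @differential_section 1.
rewrite subrr in sG sP; exists (idfun \- (s \o D 0)); split=> [x Gx|z [Gz Dz]] /=.
  have GDx : G 1 (D 0 x) by rewrite -[1]add0r; apply: DG.
  split; first by apply: GB => //; apply: sG.
  by rewrite linearB /= sP ?subrr // -[1]add0r DD.
by rewrite Dz linear0 subr0.
Qed.

Lemma Z0_sum (T : finType) (a : T -> R) (y : T -> V) :
  (forall t, Z0 (y t)) -> Z0 (\sum_t a t *: y t).
Proof.
move=> Zy; split; first by apply: G_sum => t; have [] := Zy t.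
by rewrite linear_sum big1 // => t _; have [_ Dy] := Zy t; rewrite linearZ /= Dy scaler0.
Qed.

Lemma B0_sum (T : finType) (a : T -> R) (y : T -> V) :
  (forall t, B0 (y t)) -> B0 (\sum_t a t *: y t).
Proof.
move=> /fin_all_exists2 [z zG zP]; exists (\sum_t a t *: z t); first exact: G_sum.
by rewrite linear_sum; apply: eq_bigr => t _; rewrite linearZ /= zP.
Qed.

Lemma B0D x y : B0 x -> B0 y -> B0 (x + y).
Proof.
move=> [u uG <-] [v vG <-]; exists (u + v); last by rewrite linearD.
by rewrite -[u]scale1r; apply: G_lin.
Qed.

Lemma B0Z a x : B0 x -> B0 (a *: x).
Proof.
move=> [u uG <-]; exists (a *: u); last by rewrite linearZ.
by rewrite -[_ *: _]addr0; apply: G_lin.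
Qed.

Lemma B0B x y : B0 x -> B0 y -> B0 (x - y).
Proof. by move=> Bx By; apply: B0D => //; rewrite -scaleN1r; apply: B0Z. Qed.

Lemma H0_free_reduced_exact :
  (forall x, G (- 1) x -> D (- 1) x = 0 -> exists2 y, G (- 2) y & D (- 2) y = x) ->
  H0_free -> reduced_exact.
Proof.
move=> exact_neg [I [e [Ze gen ind]]] h Gh [p [a [y [ma Gy hP]]]].
(* The [y t] need not be cocycles, but [D h] is one, so applying [rho] replaces each [y t] by a
   cocycle. *)
have [rho [rhoG rhoP]] := cocycle_retraction.
have ZDh : Z0 (D (- 1) h) by split; [apply: (DG (n := - 1)) | apply: (DD (n := - 1))].
have [n [k [s [k_inj sP]]]] := common_support (fun t => gen _ (rhoG _ (Gy t))).
have {sP}/fin_all_exists2 [u uG uP] := sP.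
have key : \sum_l (\sum_t a t * s t l) *: e (k l) = D (- 1) (h - \sum_t a t *: u t).
  rewrite linearB /= -(rhoP _ ZDh) hP !linear_sum -big_split /=.
  under eq_bigr do rewrite scaler_suml.
  rewrite exchange_big; apply: eq_bigr => t _ /=.
  rewrite !linearZ /= uP -scalerDr opprB addrC subrK scaler_sumr.
  by apply: eq_bigr => l _; rewrite scalerA.
have Gx : G (- 1) (h - \sum_t a t *: u t) by apply: GB => //; apply: G_sum.
(* Freeness kills the left side of [key], so [h - \sum_t a t *: u t] is a cocycle, hence some [D g];
   then [h - D g] is the sum of the [a t *: u t]. *)
have s0 : forall l, \sum_t a t * s t l = 0.
  by apply: (ind _ k) => //; exists (h - \sum_t a t *: u t); rewrite ?key.
have [|g Gg gP] := exact_neg _ Gx.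
  by rewrite -key big1 // => l _; rewrite s0 scale0r.
by exists g => //; exists p, a, u; split=> //; rewrite gP subKr.
Qed.

Hypotheses (idm : is_ideal m) (sep : forall x, (forall n, ideal_exp m n x) -> x = 0).
Hypothesis unitm : forall x, ~ m x -> exists y, y * x = 1.

Definition generates n (phi : 'I_n -> V) :=
  (forall i, Z0 (phi i)) /\ forall z, Z0 z -> exists r, B0 (z - \sum_i r i *: phi i).

(** A relation with a coefficient outside [m], hence invertible, could be solved for the
    corresponding generator, against minimality. The images under the retraction of a dual basis of
    [G 0] show that some finite system exists. *)
Lemma minimal_generators : exists n (phi : 'I_n -> V), generates phi /\
  forall r : 'I_n -> R, B0 (\sum_i r i *: phi i) -> forall i, m (r i).
Proof.
have [rho [rhoG rhoP]] := cocycle_retraction.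
have [T [e [c [Ge eP]]]] := projG 0.
have ex : exists n, `[< exists phi : 'I_n -> V, generates phi >].
  exists #|T|; apply/asboolP; exists (fun i => rho (e (enum_val i))).
  split=> [i|z Zz]; first exact: rhoG.
  exists (fun i => c (enum_val i) z).
  rewrite -{1}(rhoP z Zz) {1}(eP z (proj1 Zz)) linear_sum.
  rewrite (reindex _ (onW_bij _ (enum_val_bij T))) /= -sumrB big1.
    by exists 0; rewrite ?linear0.
  by move=> i _; rewrite linearZ subrr.
have [n /asboolP [phi [Zphi phiP]] n_min] := ex_minnP ex.
exists n, phi; split=> //.
case: n => [|n] in phi Zphi phiP n_min * => r Br j; first by case: j.
apply: contrapT => /unitm [u ur].
suff : (n < n)%N by rewrite ltnn.
apply/n_min/asboolP; exists (phi \o lift j); split=> [i|z Zz]; first exact: Zphi.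
have [s sP] := phiP z Zz.
(* Modulo coboundaries, [phi j] is [- u] times the sum of the other terms of the relation; this
   value is substituted. *)
exists (fun i => s (lift j i) - s j * u * r (lift j i)).
rewrite [X in B0 X](_ : _ = (z - \sum_i s i *: phi i) + (s j * u) *: \sum_i r i *: phi i).
  by apply: B0D => //; apply: B0Z.
rewrite -addrA; congr (_ + _).
rewrite !(bigD1_ord j) //= scalerDr scalerA -mulrA ur mulr1 opprD addrACA addNr add0r.
rewrite scaler_sumr -!sumrN -big_split /=; apply: eq_bigr => i _.
by rewrite scalerBl scalerA opprB addrC.
Qed.

Lemma reduced_exact_H0_free : reduced_exact -> H0_free.
Proof.
move=> ex0.
have [rho [rhoG rhoP]] := cocycle_retraction.
have [T [e [c [Ge eP]]]] := projG 0.
have [n [phi [[Zphi phiP] phim]]] := minimal_generators.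
have /fin_all_exists [s sP] : forall t, exists r, B0 (rho (e t) - \sum_i r i *: phi i).
  by move=> t; apply: phiP; apply: rhoG.
pose rel (r : 'I_n -> R) := B0 (\sum_i r i *: phi i).
(* Coordinates of a cocycle with respect to [phi], modulo coboundaries, chosen linearly through the
   dual basis of [G 0]. *)
pose co z i := \sum_t (c t z : R) * s t i.
have coP z : Z0 z -> B0 (z - \sum_i co z i *: phi i).
  move=> Zz; rewrite [X in B0 X](_ : _ = \sum_t (c t z : R) *: (rho (e t) - \sum_i s t i *: phi i)).
    exact: B0_sum.
  rewrite -{1}(rhoP z Zz) {1}(eP z (proj1 Zz)) linear_sum.
  under [in RHS]eq_bigr do rewrite scalerBr.
  rewrite sumrB; congr (_ - _); first by apply: eq_bigr => t _; rewrite linearZ.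
  under eq_bigr do rewrite scaler_suml.
  rewrite exchange_big; apply: eq_bigr => t _; rewrite scaler_sumr.
  by apply: eq_bigr => i _; rewrite scalerA.
have co_sum i (T' : finType) (a : T' -> R) (y : T' -> V) :
    co (\sum_j a j *: y j) i = \sum_j a j * co (y j) i.
  under [RHS]eq_bigr do rewrite mulr_sumr.
  rewrite exchange_big; apply: eq_bigr => t _ /=.
  by rewrite linear_sum mulr_suml; apply: eq_bigr => j _; rewrite linearZ mulrA.
(* [co] is applied to both sides of [\sum_j r j *: phi j = \sum_l a l *: D (- 1) (y l)]. The
   differences between the unit vectors and the [co (phi j)] are relations, as are the
   [co (D (- 1) (y l))]; [r] is their combination with the coefficients [r j] and [a l], which lie
   in [m]. *)
have rel_m r : rel r -> exists (T' : finType) (a : T' -> R) (k : T' -> 'I_n -> R),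
    [/\ forall t, m (a t), forall t, rel (k t) & forall i, r i = \sum_t a t * k t i].
  move=> rr; have [h Gh hP] := rr.
  have [|g Gg [p [a [y [ma Gy yP]]]]] := ex0 h Gh.
    by exists n, r, phi; split=> // [|k]; [exact: phim | have [] := Zphi k].
  have ZDy l : Z0 (D (- 1) (y l)).
    by split; [apply: (DG (n := - 1)) | apply: (DD (n := - 1))].
  exists ('I_n + 'I_p)%type,
    (fun x => match x with inl j => r j | inr l => a l end),
    (fun x i => match x with
       | inl j => (i == j)%:R - co (phi j) i
       | inr l => co (D (- 1) (y l)) i end).
  split=> [[j|l]|[j|l]|i] //; first exact: phim.
  - rewrite /rel [X in B0 X](_ : _ = phi j - \sum_i co (phi j) i *: phi i); first exact: coP.
    under eq_bigr do rewrite scalerBl.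
    rewrite sumrB; congr (_ - _); rewrite (bigD1 j) //= eqxx scale1r big1 ?addr0 //.
    by move=> i /negbTE ->; rewrite scale0r.
  - have BDy : B0 (D (- 1) (y l)) by exists (y l).
    by have := B0B BDy (coP _ (ZDy l)); rewrite subKr.
  - have eqDh : \sum_j r j *: phi j = \sum_l a l *: D (- 1) (y l).
      have DDg : D (- 1) (D (- 2) g) = 0 by apply: (DD Gg).
      rewrite -hP -[LHS]subr0 -[X in _ - X = _]DDg -linearB yP linear_sum.
      by apply: eq_bigr => l _; rewrite linearZ.
    rewrite big_sumType /=.
    under eq_bigr do rewrite mulrBr.
    rewrite sumrB -co_sum eqDh co_sum subrK (bigD1 i) //= eqxx mulr1 big1 ?addr0 //.
    by move=> j /negbTE ji; rewrite eq_sym ji mulr0.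
have rel0 r : rel r -> forall i, r i = 0.
  move=> rr i; apply: sep => k; elim: k r rr i => [//|k ih] r /rel_m [T' [a [b [ma rb rP]]]] i.
  by rewrite rP; apply: ideal_mul_sum => // t; apply: ih.
exists 'I_n, phi; split=> // [z Zz|p k r k_inj Br l].
  by have [r rP] := phiP z Zz; exists n, id, r.
(* Extending the coefficients by zero along the injective [k] gives a relation among all the
   [phi i]. *)
pose r' i := \sum_(l | k l == i) r l.
have <- : r' (k l) = r l.
  by rewrite /r' (bigD1 l) //= big1 ?addr0 // => j /andP [/eqP /k_inj -> /eqP].
apply: rel0; rewrite /rel /r'.
under eq_bigr do rewrite scaler_suml.
rewrite (exchange_big_dep xpredT) //= (eq_bigr (fun l => r l *: phi (k l))) // => j _.
by rewrite (big_pred1 (k j)).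
Qed.

End Nonpositive.

(** * The Hom complex *)

Section AlgebraModule.
Variables (R : comNzRingType) (L : ralgebra R).

Definition alg_module : Type := L.
HB.instance Definition _ := GRing.Zmodule.copy alg_module L.

Definition alg_scale (r : R) (x : alg_module) : alg_module := alg_map L r * (x : L).

Lemma alg_scaleA a b x : alg_scale a (alg_scale b x) = alg_scale (a * b) x.
Proof. by rewrite /alg_scale mulrA -rmorphM. Qed.

Lemma alg_scale1 : left_id 1 alg_scale.
Proof. by move=> x; rewrite /alg_scale rmorph1 mul1r. Qed.

Lemma alg_scaleDr : right_distributive alg_scale +%R.
Proof. by move=> a x y; rewrite /alg_scale mulrDr. Qed.

Lemma alg_scaleDl x : {morph alg_scale^~ x : a b / a + b}.
Proof. by move=> a b; rewrite /alg_scale rmorphD mulrDl. Qed.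

HB.instance Definition _ := GRing.Zmodule_isLmodule.Build R alg_module
  alg_scaleA alg_scale1 alg_scaleDr alg_scaleDl.

(** Finitely many generators involve only finitely many members of the given basis; these form a
    basis already, and uniqueness makes the coordinates linear. *)
Lemma alg_finite_projective : noetherian_algebra L -> alg_free L ->
  finite_projective (fun _ : alg_module => True).
Proof.
move=> [_ [n [g gP]]] [I [e [gen ind]]].
have [|N [k [s [k_inj sP]]]] :=
  @common_support R alg_module (fun x => x = 0) I e 'I_n g.
  move=> t; have [N [k [r rP]]] := gen (g t); exists N, k, r.
  by apply/eqP; rewrite subr_eq0; apply/eqP.
have uniq (r r' : 'I_N -> R) : \sum_l r l *: (e (k l) : alg_module) =
    \sum_l r' l *: (e (k l) : alg_module) -> forall l, r l = r' l.
  move=> err l; apply/eqP; rewrite -subr_eq0; apply/eqP.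
  apply: (ind N k (fun l => r l - r' l)) => //; apply/esym.
  transitivity (\sum_l (r l - r' l) *: (e (k l) : alg_module)) => //.
  by under eq_bigr do rewrite scalerBl; rewrite sumrB err subrr.
have : forall x : alg_module, exists r : 'I_N -> R, x = \sum_l r l *: (e (k l) : alg_module).
  move=> x; have [r xr] := gP x; exists (fun l => \sum_t r t * s t l).
  transitivity (\sum_t r t *: (g t : alg_module)); first exact: xr.
  under [RHS]eq_bigr do rewrite scaler_suml.
  rewrite exchange_big; apply: eq_bigr => t _ /=.
  have /eqP := sP t; rewrite subr_eq0 => /eqP ->.
  by rewrite scaler_sumr; apply: eq_bigr => l _; rewrite scalerA.
move=> /choice [c cP].
have cl l : linear ((fun x => c x l) : alg_module -> R^o).
  move=> a x y; apply: (uniq (c (a *: x + y)) (fun l => a * c x l + c y l)).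
  rewrite -cP {1}(cP x) {1}(cP y) scaler_sumr -big_split.
  by apply: eq_bigr => i _; rewrite scalerDl scalerA.
by exists 'I_N, (fun l => e (k l)), (fun l => mk_linear (cl l)).
Qed.

End AlgebraModule.

Section HomModule.
Variables (R : comNzRingType) (m : R -> Prop) (L : ralgebra R).
Hypothesis idm : is_ideal m.
Local Notation K := ((L : pzRingType)^c).

Lemma ideal_sum n (a b : 'I_n -> R) : (forall k, m (a k)) -> m (\sum_k a k * b k).
Proof.
have [m0 mD mZ] := idm => ma; elim/big_ind: _ => // k _.
by rewrite mulrC; apply: mZ.
Qed.

(* The functionals are evaluations at [g t] followed by functionals of [N], so
   they make sense for arbitrary functions [M -> N], not only for linear ones. *)
Lemma hom_dual_basis (M N : lmodType K) :
  noetherian_algebra L -> alg_free L ->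
  fin_gen M -> projective M -> fin_gen N -> projective N ->
  exists (T : finType) (e : T -> {linear M -> N}) (g : T -> M) (c : T -> N -> R),
    [/\ forall t a x y, c t ((alg_map L a : K) *: x + y) = a * c t x + c t y,
        forall t x, in_mM m x -> m (c t x) &
        forall (f : {linear M -> N}) x,
          f x = \sum_t (alg_map L (c t (f (g t))) : K) *: e t x].
Proof.
move=> noL freeL fgM pM fgN pN.
have [S [b [beta [_ bP]]]] := alg_finite_projective noL freeL.
have [p [g [c cP]]] := dual_basis fgM pM.
have [q [g' [c' cP']]] := dual_basis fgN pN.
(* [E (i, (j, s))] is the functional [c i] followed by the map sending 1 to [b s] acting on [g' j];
   [ph] is the matching coordinate, first over [L], then over [R]. *)
pose E (t : 'I_p * ('I_q * S)) (x : M) : N :=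
  ((c t.1 x : K) * (b t.2.2 : K)) *: g' t.2.1.
have El t : linear (E t).
  by move=> a x y; rewrite /E linearP mulrDl scalerDl -mulrA scalerA.
pose ph (t : 'I_p * ('I_q * S)) (y : N) : R := beta t.2.2 (c' t.2.1 y : alg_module L).
have phl t a x y : ph t ((alg_map L a : K) *: x + y) = a * ph t x + ph t y.
  rewrite /ph linearP.
  rewrite -[RHS](linearP (beta t.2.2) a (c' t.2.1 x : alg_module L) (c' t.2.1 y : alg_module L)).
  congr (beta t.2.2 (_ + _)).
  exact: esym (alg_central a (c' t.2.1 x : L)).
exists ('I_p * ('I_q * S))%type, (fun t => mk_linear (El t)), (fun t => g t.1), ph.
split=> // [t x [n [a [y [ma ->]]]]|f x].
  have ph0 : ph t 0 = 0.
    rewrite /ph (linear0 (c' t.2.1)); exact: (linear0 (beta t.2.2)).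
  rewrite (_ : ph t _ = \sum_k a k * ph t (y k)); first exact: ideal_sum.
  by elim/big_rec2: _ => [|k u v _ uv]; rewrite ?phl ?uv.
rewrite {1}(cP x) linear_sum /=.
rewrite -(pair_bigA _ (fun i t => (alg_map L (ph (i, t) (f (g i))) : K) *: E (i, t) x)) /=.
apply: eq_bigr => i _; rewrite linearZ /= {1}(cP' (f (g i))) scaler_sumr.
rewrite -(pair_bigA _ (fun j s => (alg_map L (ph (i, (j, s)) (f (g i))) : K) *: E (i, (j, s)) x)) /=.
apply: eq_bigr => j _.
have e1 : (c' j (f (g i)) : K) = \sum_s (b s : K) * (alg_map L (ph (i, (j, s)) (f (g i))) : K).
  exact: (bP (c' j (f (g i)) : alg_module L) Logic.I).
rewrite {1}e1 scaler_suml scaler_sumr; apply: eq_bigr => s _.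
by rewrite /E /= -!scalerA !central_scale.
Qed.

End HomModule.

Section HomFamilies.
Variables (R : comNzRingType) (m : R -> Prop) (L : ralgebra R).
Local Notation K := ((L : pzRingType)^c).
Variable P : complex K.

(* All degrees of the Hom complex of [P] live in the R-module of families of
   functions indexed by pairs of degrees. *)
Definition hom_family : Type := forall i j : int, P i -> P j.

HB.instance Definition _ := gen_eqMixin hom_family.
HB.instance Definition _ := gen_choiceMixin hom_family.

Definition hom_family_add (f g : hom_family) : hom_family := fun i j x => f i j x + g i j x.
Definition hom_family_opp (f : hom_family) : hom_family := fun i j x => - f i j x.
Definition hom_family_zero : hom_family := fun i j x => 0.
Definition hom_family_scale (r : R) (f : hom_family) : hom_family :=
  fun i j x => (alg_map L r : K) *: f i j x.

Lemma hom_familyP (f g : hom_family) : (forall i j x, f i j x = g i j x) -> f = g.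
Proof.
move=> e; apply: functional_extensionality_dep => i.
by apply: functional_extensionality_dep => j; apply: functional_extensionality_dep.
Qed.

Lemma hom_family_addA : associative hom_family_add.
Proof. by move=> f g h; apply: hom_familyP => i j x; apply: addrA. Qed.
Lemma hom_family_addC : commutative hom_family_add.
Proof. by move=> f g; apply: hom_familyP => i j x; apply: addrC. Qed.
Lemma hom_family_add0 : left_id hom_family_zero hom_family_add.
Proof. by move=> f; apply: hom_familyP => i j x; apply: add0r. Qed.
Lemma hom_family_addN : left_inverse hom_family_zero hom_family_opp hom_family_add.
Proof. by move=> f; apply: hom_familyP => i j x; apply: addNr. Qed.

HB.instance Definition _ := GRing.isZmodule.Build hom_family
  hom_family_addA hom_family_addC hom_family_add0 hom_family_addN.

Lemma hom_family_scaleA a b f : hom_family_scale a (hom_family_scale b f) = hom_family_scale (a * b) f.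
Proof.
apply: hom_familyP => i j x; rewrite /hom_family_scale scalerA; congr (_ *: _).
by rewrite mulrC (rmorphM (alg_map L)).
Qed.

Lemma hom_family_scale1 : left_id 1 hom_family_scale.
Proof.
move=> f; apply: hom_familyP => i j x.
by rewrite /hom_family_scale (rmorph1 (alg_map L)) scale1r.
Qed.

Lemma hom_family_scaleDr : right_distributive hom_family_scale +%R.
Proof. by move=> a f g; apply: hom_familyP => i j x; apply: scalerDr. Qed.

Lemma hom_family_scaleDl f : {morph hom_family_scale^~ f : a b / a + b}.
Proof.
move=> a b; apply: hom_familyP => i j x.
by rewrite /hom_family_scale (rmorphD (alg_map L)) scalerDl.
Qed.

HB.instance Definition _ := GRing.Zmodule_isLmodule.Build R hom_family
  hom_family_scaleA hom_family_scale1 hom_family_scaleDr hom_family_scaleDl.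

Lemma hom_familyD (f g : hom_family) i j x : (f + g) i j x = f i j x + g i j x.
Proof. by []. Qed.
Lemma hom_familyN (f : hom_family) i j x : (- f) i j x = - f i j x.
Proof. by []. Qed.
Lemma hom_familyZ a (f : hom_family) i j x : (a *: f) i j x = (alg_map L a : K) *: f i j x.
Proof. by []. Qed.
Lemma hom_family_sum (T : finType) (f : T -> hom_family) i j x :
  (\sum_t f t) i j x = \sum_t f t i j x.
Proof. by elim/big_rec2: _ => // t u v _ <-. Qed.

Definition of_degree n (f : hom_family) :=
  (forall i j, linear (f i j)) /\ (forall i j x, j <> i + n -> f i j x = 0).

Lemma of_degree_lin n a f g : of_degree n f -> of_degree n g -> of_degree n (a *: f + g).
Proof.
move=> [fl fs] [gl gs]; split=> [i j b x y|i j x ne].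
  rewrite !(hom_familyD, hom_familyZ) fl gl !scalerDr central_scale.
  by rewrite -!addrA; congr (_ + _); rewrite addrCA.
by rewrite hom_familyD hom_familyZ fs // gs // scaler0 addr0.
Qed.

Lemma of_degree_fun0 n f i j : of_degree n f -> f i j 0 = 0.
Proof. by move=> [fl _]; apply: (linear0 (mk_linear (fl i j))). Qed.

Lemma of_degree0 n : of_degree n 0.
Proof. by split=> // i j a x y; rewrite -[LHS]/0 scaler0 addr0. Qed.

Section Differential.
Variable n : int.

(** The usual [d f - (-1)^n f d]. The degree [n] is an argument because the type of families does
    not record it. *)
Definition differential (f : hom_family) : hom_family := fun i k x =>
  cdiff P (k - 1) k (f i (k - 1) x) - shift_sign n idfun (f (i + 1) k (cdiff P i (i + 1) x)).

Arguments differential : clear implicits.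

Lemma differential_linear : linear differential.
Proof.
move=> a f g; apply: hom_familyP => i k x.
rewrite !(hom_familyD, hom_familyZ) /differential !(hom_familyD, hom_familyZ) !linearP.
by rewrite scalerDr addrACA.
Qed.

HB.instance Definition _ := GRing.isLinear.Build R hom_family hom_family *:%R
  differential differential_linear.

Lemma differentialE f i j k x : k = j + 1 -> differential f i k x =
  cdiff P j k (f i j x) - shift_sign n idfun (f (i + 1) k (cdiff P i (i + 1) x)).
Proof.
move=> e; have -> : j = k - 1 by rewrite e addrK.
by [].
Qed.

End Differential.
Arguments differential : clear implicits.

Lemma shift_sign_idfunS (M : lmodType K) n (x : M) :
  shift_sign (n + 1) idfun x = - shift_sign n idfun x.
Proof.
rewrite /shift_sign; have -> : odd `|(n + 1)%R|%N = ~~ odd `|n|%N by lia.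
by case: (odd _); rewrite ?opprK.
Qed.

Lemma shift_signK (M : lmodType K) n (x : M) :
  shift_sign n idfun (shift_sign n idfun x) = x.
Proof. by rewrite /shift_sign; case: (odd _); rewrite ?opprK. Qed.

Lemma of_degree_differential n f : of_degree n f -> of_degree (n + 1) (differential n f).
Proof.
move=> [fl fs]; split=> [i k a x y|i k x ne].
  rewrite /differential (linearP (cdiff P i (i + 1))) !fl !linearP.
  by rewrite scalerDr addrACA.
rewrite /differential !fs ?linear0 ?addr0 //; move=> e; apply: ne; lia.
Qed.

Lemma differentialK n f : of_degree n f -> differential (n + 1) (differential n f) = 0.
Proof.
move=> fn; apply: hom_familyP => i k x.
rewrite /differential cdiffK (of_degree_fun0 _ _ fn) shift_sign_idfunS linear0 subr0 opprK.
rewrite linearB /= cdiffK sub0r /shift_sign.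
by case: (odd _); rewrite ?linearN /= ?opprK ?addNr ?subrr.
Qed.

End HomFamilies.
Arguments differential {R L P} n f.
Arguments of_degree {R L P} n f.

Section HomComplex.
Variables (R : comNzRingType) (m : R -> Prop) (L : ralgebra R).
Local Notation K := ((L : pzRingType)^c).
Variable P : complex K.
Hypotheses (idm : is_ideal m) (noL : noetherian_algebra L) (freeL : alg_free L).
Hypothesis spP : strictly_perfect P.

(** Dual bases of the modules of maps from [P i] to [P (i + n)] are assembled over the finitely many
    degrees where [P] may be nonzero. The last clause relates pointwise reduction modulo [m] to
    reduction of the Hom complex. *)
Lemma of_degree_dual_basis n :
  exists (T : finType) (e : T -> hom_family P) (c : T -> {linear hom_family P -> R^o}),
  [/\ forall t, of_degree n (e t),
      forall f, of_degree n f -> f = \sum_t (c t f : R) *: e t &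
      forall f t, (forall i j x, in_mM m (f i j x)) -> m (c t f)].
Proof.
have [projP [b bP]] := spP.
(* [dg] lists the degrees from [- |b|] to [|b|]. *)
pose dg (i : 'I_(`|b| + `|b| + 1)%N) : int := (i : nat)%:Z - `|b|%:Z.
have H i := hom_dual_basis idm noL freeL (proj1 (projP (dg i))) (proj2 (projP (dg i)))
              (proj1 (projP (dg i + n))) (proj2 (projP (dg i + n))).
move: H => /fin_all_exists [T /fin_all_exists [e /fin_all_exists [g /fin_all_exists [c H]]]].
pose E (u : {i & T i}) : hom_family P := fun i j x =>
  pcast P (dg (tag u) + n) j (e (tag u) (tagged u) (pcast P i (dg (tag u)) x)).
pose C (u : {i & T i}) (f : hom_family P) : R^o :=
  c (tag u) (tagged u) (f (dg (tag u)) (dg (tag u) + n) (g (tag u) (tagged u))).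
have Cl u : linear (C u) by move=> a f f'; rewrite /C; have [-> _ _] := H (tag u).
exists {i & T i}, E, (fun u => mk_linear (Cl u)).
have E0 u i j x : j <> i + n -> E u i j x = 0.
  move=> ne; rewrite /E; have [e1|/eqP ne1] := eqVneq i (dg (tag u)).
    by rewrite pcast0 // -e1 => e2; apply: ne; rewrite e2.
  by rewrite (pcast0 _ ne1) !linear0.
split=> [u|f fn|f u fm]; last first.
- by have [_ h _] := H (tag u); apply: h.
- have [fl fs] := fn; apply: hom_familyP => i j x; rewrite hom_family_sum /=.
  have [->{j}|/eqP ne] := eqVneq j (i + n); last first.
    by rewrite fs // big1 // => u _; rewrite hom_familyZ E0 // scaler0.
  have [le_ib|lt_bi] := leP `|i| `|b|; last first.
    have -> : x = 0 by apply: (bP i); lia.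
    rewrite (of_degree_fun0 _ _ fn) big1 // => u _.
    by rewrite hom_familyZ /E !linear0 scaler0.
  have [i0 ei] : exists i0, i = dg i0.
    have lt_i : (`|(i + `|b|%:Z)%R|%N < `|b| + `|b| + 1)%N by lia.
    by exists (Ordinal lt_i); rewrite /dg /=; lia.
  case: _ / (esym ei) x => x {i ei le_ib}.
  transitivity (\sum_(i1 | true) \sum_(t : T i1 | true)
      ((C (Tagged T t) f : R) *: E (Tagged T t)) (dg i0) (dg i0 + n) x); last first.
    by rewrite sig_big_dep; apply: eq_bigr => -[i1 t] _.
  rewrite (bigD1 i0) //= [X in _ = _ + X]big1 ?addr0 => [|i1 ne_i].
    have [_ _ /(_ (mk_linear (fl (dg i0) (dg i0 + n))) x)] := H i0 => /= ->.
    by apply: eq_bigr => t _; rewrite hom_familyZ /E /C /= !pcast_id.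
  rewrite big1 // => t _; rewrite hom_familyZ /E /=.
  have ne_dg : dg i0 <> dg i1.
    by move=> /addIr [] e1; case/eqP: ne_i; apply: val_inj.
  by rewrite (pcast0 _ ne_dg) !linear0 scaler0.
split=> [i j a x y|i j x ne]; last exact: E0.
by rewrite /E !linearP.
Qed.

Lemma of_degree_finite_projective n : finite_projective (of_degree (P := P) n).
Proof. by have [T [e [c [h1 h2 _]]]] := of_degree_dual_basis n; exists T, e, c. Qed.

(** The coordinates in the dual basis are the required coefficients: they lie in [m] once all values
    lie in [m P]. *)
Lemma in_mGP n (f : hom_family P) :
  of_degree n f -> (forall i j x, in_mM m (f i j x)) -> in_mG m (of_degree (P := P)) n f.
Proof.
move=> fn fm; have [T [e [c [eP cP cm]]]] := of_degree_dual_basis n.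
exists #|T|, (fun i => c (enum_val i) f), (fun i => e (enum_val i)); split=> [k|k|] //.
  exact: cm.
by rewrite {1}(cP f fn) (reindex _ (onW_bij _ (enum_val_bij T))).
Qed.

Lemma in_mG_in_mM n (f : hom_family P) i j x : in_mG m (of_degree (P := P)) n f -> in_mM m (f i j x).
Proof.
move=> [p [a [y [ma _ ->]]]]; exists p, a, (fun k => y k i j x); split=> //.
exact: hom_family_sum.
Qed.

Lemma of_degree_bounded : exists N : nat, forall n, N%:Z < n ->
  forall f : hom_family P, of_degree n f -> f = 0.
Proof.
have [_ [b bP]] := spP; exists (`|b| + `|b|)%N => n n_gt f fn; have [_ fs] := fn.
apply: hom_familyP => i j x; have [ej|/eqP ne] := eqVneq j (i + n); last by rewrite fs.
have [lt_bi|le_ib] := ltP `|b| `|i|.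
  have -> : x = 0 by apply: (bP i); lia.
  exact: (of_degree_fun0 _ _ fn).
by apply: (bP j); lia.
Qed.

End HomComplex.

(** * Cocycles of the Hom complex as chain maps *)

Section Translation.
Variables (R : comNzRingType) (m : R -> Prop) (L : ralgebra R).
Local Notation K := ((L : pzRingType)^c).
Variable P : complex K.
Local Notation G := (of_degree (P := P)).
Local Notation D := (differential (P := P)).

(** A homotopy has components between all pairs of degrees; only those of one fixed degree belong to
    the Hom complex. *)
Definition cut n (h : hom_family P) : hom_family P :=
  fun i j x => if j == i + n then h i j x else 0.

Arguments cut n h : clear implicits.

Lemma cut_of_degree n h : (forall i j, linear (h i j)) -> G n (cut n h).
Proof.
move=> hl; split=> [i j a x y|i j x /eqP/negbTE ne]; rewrite /cut; last by rewrite ne.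
by case: ifP => _; rewrite ?hl // scaler0 addr0.
Qed.

Lemma cutE n (h : hom_family P) i j x : j = i + n -> cut n h i j x = h i j x.
Proof. by move/eqP=> e; rewrite /cut e. Qed.

Lemma of_degreeP n (f g : hom_family P) : G n f -> G n g ->
  (forall i j x, j = i + n -> f i j x = g i j x) -> f = g.
Proof.
move=> [_ fs] [_ gs] e; apply: hom_familyP => i j x.
have [ej|/eqP ne] := eqVneq j (i + n); first exact: e.
by rewrite fs // gs.
Qed.

Lemma shift_chain_map n (f : hom_family P) : G n f -> D n f = 0 ->
  exists u : chain_map P (shift P n), forall i x, u i x = f i (i + n) x.
Proof.
move=> fn Df; have [fl _] := fn.
pose u i : {linear P i -> shift P n i} := mk_linear (fl i (i + n)).
have uP i j x : u j (cdiff P i j x) = cdiff (shift P n) i j (u i x).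
  have [->{j}|/eqP ne] := eqVneq j (i + 1); last first.
    by rewrite !cdiff_shape // linear0.
  rewrite /= -[RHS]/(shift_sign n idfun (cdiff P (i + n) (i + 1 + n) (f i (i + n) x))).
  have := congr1 (fun g : hom_family P => g i (i + 1 + n) x) Df.
  rewrite /= (@differentialE _ _ _ _ _ _ (i + n)); last by lia.
  by move=> /eqP; rewrite subr_eq0 => /eqP ->; rewrite shift_signK.
by exists (ChainMap uP).
Qed.

Lemma exact_of_null n :
  (forall u : chain_map P (shift P n), homotopic u (chain_zero P (shift P n))) ->
  forall f, G n f -> D n f = 0 -> exists2 y, G (n - 1) y & D (n - 1) y = f.
Proof.
move=> null f fn Df; have [u uP] := shift_chain_map fn Df; have [h hP] := null u.
(* With [y = (-1)^n h], the Hom differential [d y - (-1)^(n-1) y d] equals [(-1)^n d h + h d], the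
   null homotopy formula for [P[n]]. *)
pose y0 : hom_family P := fun i j x =>
  shift_sign n idfun (pcast P (j - n + n) j (h i (j - n) x)).
have yn : G (n - 1) (cut (n - 1) y0).
  by apply: cut_of_degree => i j a x x'; rewrite /y0 !linearP.
have y0E i j j' x : j' = j + n -> y0 i j' x = shift_sign n idfun
    (pcast P (j + n) j' (h i j x)).
  move=> e; rewrite /y0; congr (shift_sign n idfun _).
  by have -> : j = j' - n by rewrite e addrK.
exists (cut (n - 1) y0) => //.
have Dyn := of_degree_differential yn; rewrite subrK in Dyn.
apply: (of_degreeP Dyn fn) => i k x ->.
rewrite -uP -[u i x]subr0 -[X in u i x - X]/(chain_zero P (shift P n) i x) hP.
rewrite (@differentialE _ _ _ _ _ _ (i - 1 + n)); last by lia.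
rewrite !cutE; [|by lia|by lia].
rewrite (y0E _ (i - 1)) // (y0E _ i) // !pcast_id.
have sgK (z : P (i + n)) : - shift_sign (n - 1) idfun (shift_sign n idfun z) = z.
  have := shift_sign_idfunS (n - 1) z; rewrite subrK => ->.
  by rewrite linearN opprK /= shift_signK.
rewrite sgK; congr (_ + _).
by rewrite /= /shift_sign; case: (odd _); rewrite ?linearN.
Qed.

Lemma chain_map_Z0 (f : hom_family P) : Z0 G D f ->
  exists u : chain_map P P, forall i x, u i x = f i i x.
Proof.
move=> [fn Df]; have [fl _] := fn.
have uP i j x : mk_linear (fl j j) (cdiff P i j x) = cdiff P i j (mk_linear (fl i i) x).
  have [->{j}|/eqP ne] := eqVneq j (i + 1); last first.
    by rewrite !cdiff_shape // linear0.
  have := congr1 (fun g : hom_family P => g i (i + 1) x) Df.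
  rewrite /= (@differentialE _ _ _ _ _ _ i) //.
  by move=> /eqP; rewrite subr_eq0 => /eqP ->.
by exists (ChainMap uP).
Qed.

Lemma Z0_chain_map (u : chain_map P P) :
  exists2 f : hom_family P, Z0 G D f & forall i x, f i i x = u i x.
Proof.
pose f0 : hom_family P := fun i j x => pcast P i j (u i x).
have fn : G 0 (cut 0 f0) by apply: cut_of_degree => i j a x y; rewrite /f0 !linearP.
have fE i x : cut 0 f0 i i x = u i x by rewrite cutE ?addr0 // /f0 pcast_id.
exists (cut 0 f0) => //; split=> //.
apply: (of_degreeP (of_degree_differential fn) (@of_degree0 _ _ _ _)) => i k x.
rewrite add0r => ->.
rewrite (@differentialE _ _ _ _ _ _ i) // !fE chain_comm.
exact: subrr.
Qed.

Lemma null_homotopicP (u : chain_map P P) (f : hom_family P) :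
  Z0 G D f -> (forall i x, u i x = f i i x) ->
  homotopic u (chain_zero P P) <-> B0 G D f.
Proof.
move=> [fn Df] uf; split=> [[h hP]|[y yn yP]].
  have yn : G (- 1) (cut (- 1) (fun i j x => h i j x)).
    by apply: cut_of_degree => i j; apply: linearP.
  exists (cut (- 1) (fun i j x => h i j x)) => //.
  apply: (of_degreeP (of_degree_differential yn) fn) => i k x.
  rewrite addr0 => ->; rewrite -uf -[u i x]subr0 -[X in u i x - X]/(chain_zero P P i x) hP /=.
  rewrite (@differentialE _ _ _ _ _ _ (i - 1)) ?subrK // !cutE ?addrK //.
  by rewrite /shift_sign /= opprK.
have [yl _] := yn; exists (fun i j => mk_linear (yl i j)) => i x /=.
rewrite subr0 uf -yP /= (@differentialE _ _ _ _ _ _ (i - 1)) ?subrK //.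
by rewrite /shift_sign /= opprK.
Qed.

Lemma homotopy_freeP : homotopy_free P <-> H0_free G D.
Proof.
have lin n (r : 'I_n -> R) (u : 'I_n -> chain_map P P) (f : 'I_n -> hom_family P) g :
    (forall l i x, u l i x = f l i i x) -> is_lincomb r u g ->
    forall i x, g i x = (\sum_l r l *: f l) i i x.
  move=> uf gP i x; rewrite gP hom_family_sum; apply: eq_bigr => l _.
  by rewrite hom_familyZ uf.
have Zsum n (r : 'I_n -> R) (f : 'I_n -> hom_family P) : (forall l, Z0 G D (f l)) ->
    Z0 G D (\sum_l r l *: f l).
  by apply: Z0_sum; [exact: of_degree_lin | exact: of_degree0].
have ZB (f g : hom_family P) : Z0 G D f -> Z0 G D g -> Z0 G D (f - g).
  move=> [fn Df] [gn Dg]; split; last by rewrite linearB Df Dg subrr.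
  by rewrite addrC -scaleN1r; apply: of_degree_lin.
split=> [[I [e [gen ind]]]|[I [e [Ze gen ind]]]].
  have : forall i, exists f : hom_family P, Z0 G D f /\ forall j x, f j j x = e i j x.
    by move=> i; have [f Zf fP] := Z0_chain_map (e i); exists f.
  move=> /choice [f fP]; exists I, f.
  have Zf i : Z0 G D (f i) by case: (fP i).
  have ef i j x : e i j x = f i j j x by have [_ ->] := fP i.
  split=> // [z Zz|n k r k_inj Bf].
    have [u uP] := chain_map_Z0 Zz; have [n [k [r [g [gP ug]]]]] := gen u.
    exists n, k, r; apply/(@null_homotopicP (chain_sub u g)).
    - by apply: ZB => //; apply: Zsum.
    - move=> i x /=; rewrite uP hom_familyD hom_familyN; congr (_ - _).
      by apply: (lin _ _ _ (fun l => f (k l)) _ _ gP).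
    - exact/homotopic_sub.
  have [g gP] := lincomb_exists r (fun l => e (k l)).
  apply: (ind _ k r g) => //; apply/(@null_homotopicP _ (\sum_l r l *: f (k l))) => //.
    exact: Zsum.
  by apply: (lin _ _ _ (fun l => f (k l)) _ _ gP).
have /choice [u uP] i := chain_map_Z0 (Ze i).
exists I, u; split=> [v|n k r g k_inj gP g0].
  have [z Zz zP] := Z0_chain_map v; have [n [k [r Bz]]] := gen z Zz.
  have [g gP] := lincomb_exists r (fun l => u (k l)).
  exists n, k, r, g; split=> //.
  apply/homotopic_sub/(@null_homotopicP _ (z - \sum_l r l *: e (k l))) => //.
    by apply: ZB => //; apply: Zsum.
  move=> i x /=; rewrite -zP hom_familyD hom_familyN; congr (_ - _).
  by apply: (lin _ _ _ (fun l => e (k l)) _ _ gP) => l; apply: uP.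
apply: (ind _ k) => //; apply/(@null_homotopicP g) => //; first exact: Zsum.
by apply: (lin _ _ _ (fun l => e (k l)) _ _ gP) => l; apply: uP.
Qed.

End Translation.
Arguments cut {R L P} n h.

(** * Reduction modulo the maximal ideal *)

Section Bar.
Variables (R : comNzRingType) (m : R -> Prop) (L : ralgebra R).
Local Notation K := ((L : pzRingType)^c).
Variable P : complex K.
Local Notation G := (of_degree (P := P)).
Local Notation D := (differential (P := P)).
Hypotheses (idm : is_ideal m) (noL : noetherian_algebra L) (freeL : alg_free L).
Hypothesis spP : strictly_perfect P.
Let pi := (@red_map R m L : {rmorphism L -> redL m L}).
Let Pbar := extend_scalars pi P.

Lemma tens_in_mM i (x : P i) : tens pi x = 0 <-> in_mM m x .
Proof. exact: tens_eq0. Qed.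

Definition lift_bar i j (f : {linear tensorB pi (P i) -> tensorB pi (P j)}) :
  {g : {linear P i -> P j} | forall x, tens pi (g x) = f (tens pi x)}.
Proof.
have [projP _] := spP; apply: cid; apply: tensor_map_lift; last exact: red_map_surj.
by have [] := projP i.
Qed.

Lemma cdiff_bar i j (x : P i) : cdiff Pbar i j (tens pi x) = tens pi (cdiff P i j x).
Proof. exact: tensorB_map_tens. Qed.

(** Degreewise lifts of chain maps and of null homotopies turn statements about the reduced complex
    into congruences modulo [m] in the Hom complex; [tens_in_mM] and [in_mGP] translate between the
    two. *)
Lemma reduced_exactP : reduced_exact m G D <->
  forall u : chain_map Pbar (shift Pbar (- 1)), homotopic u (chain_zero Pbar (shift Pbar (- 1))).
Proof.
split=> [ex u|null h hn Dh].
  pose f i := sval (lift_bar (u i : {linear tensorB pi (P i) -> tensorB pi (P (i - 1))})).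
  have fP i x : tens pi (f i x) = u i (tens pi x) by rewrite /f; case: (lift_bar _) => g ->.
  pose h0 : hom_family P := fun i j x => pcast P (i - 1) j (f i x).
  have hn : G (- 1) (cut (- 1) h0).
    by apply: cut_of_degree => i j a x y; rewrite /h0 !linearP.
  have hE i x : cut (- 1) h0 i (i - 1) x = f i x by rewrite cutE // /h0 pcast_id.
  have [|g gn gP] := ex _ hn.
    apply: in_mGP => // [|i k x]; first exact: (of_degree_differential hn).
    have [->{k}|/eqP ne] := eqVneq k (i + 1 - 1); last first.
      have [_ Ds] := of_degree_differential hn.
      rewrite /= Ds; first exact: in_mM0.
      by rewrite addr0 => e; apply: ne; rewrite e addrK.
    apply/tens_in_mM; rewrite /= (@differentialE _ _ _ _ _ _ (i - 1)); last by lia.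
    rewrite !hE /shift_sign /= opprK linearD /= -cdiff_bar !fP -cdiff_bar.
    rewrite (chain_comm u (i + 1) (tens pi x)).
    exact: subrr.
  have [gl gs] := gn.
  (* In the shift by -1 the homotopy formula reads [- d k + k d]; for [k] the reduction of [- g] it
     is the reduction of [d g - g d], the differential of [g] in degree -2. *)
  pose k i j : {linear tensorB pi (P i) -> tensorB pi (P (j - 1))} :=
    tensorB_map pi (\- mk_linear (gl i (j - 1))).
  have kE i j x : k i j (tens pi x) = - tens pi (g i (j - 1) x).
    by apply: etrans (tensorB_map_tens pi _ x) _; rewrite -linearN.
  exists (k : forall i j, {linear Pbar i -> shift Pbar (- 1) j}) => i x.
  rewrite [X in _ - X](_ : _ = 0) // subr0; move: x.
  apply: (@tens_ext _ _ _ _ _ (u i) (cdiff (shift Pbar (- 1)) (i - 1) i \o k i (i - 1)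
    \+ (k (i + 1) i \o cdiff Pbar i (i + 1)))) => x /=.
  rewrite kE (tensorB_map_tens pi (cdiff P i (i + 1))) kE.
  rewrite -[X in _ = X + _]/(- cdiff Pbar (i - 1 - 1) (i - 1) (- tens pi (g i (i - 1 - 1) x))).
  rewrite linearN opprK cdiff_bar -fP -hE.
  have /tens_in_mM := in_mG_in_mM (i - 1) x gP.
  rewrite hom_familyD hom_familyN [tens pi _]linearB => /eqP; rewrite subr_eq0 => /eqP ->.
  rewrite /= (@differentialE _ _ _ _ _ _ (i - 1 - 1)) ?subrK // linearB.
  by [].
have [hl hs] := hn.
pose u i : {linear tensorB pi (P i) -> tensorB pi (P (i - 1))} :=
  tensorB_map pi (mk_linear (hl i (i - 1))).
have uE i x : u i (tens pi x) = tens pi (h i (i - 1) x) by apply: tensorB_map_tens.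
have uP i j x : (u j : {linear Pbar j -> shift Pbar (- 1) j}) (cdiff Pbar i j x)
    = cdiff (shift Pbar (- 1)) i j (u i x).
  have [->{j}|/eqP ne] := eqVneq j (i + 1); last first.
    by rewrite !cdiff_shape // linear0.
  move: x; apply: (@tens_ext _ _ _ _ _ (u (i + 1) \o cdiff Pbar i (i + 1))
     (cdiff (shift Pbar (- 1)) i (i + 1) \o u i)) => x /=.
  rewrite uE cdiff_bar uE -[RHS]/(- cdiff Pbar (i - 1) (i + 1 - 1) (tens pi (h i (i - 1) x))).
  rewrite cdiff_bar; apply/eqP; rewrite -addr_eq0; apply/eqP.
  have /tens_in_mM := in_mG_in_mM (i + 1 - 1) x Dh.
  rewrite /= (@differentialE _ _ _ _ _ _ (i - 1)); last by lia.
  by rewrite /shift_sign /= opprK linearD => e0; rewrite -[RHS]e0; apply: addrC.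
have [k kP] := null (ChainMap uP).
pose f i j := sval (lift_bar (k i j : {linear tensorB pi (P i) -> tensorB pi (P (j - 1))})).
have fP i j x : tens pi (f i j x) = k i j (tens pi x) by rewrite /f; case: (lift_bar _) => g ->.
(* The minus sign again accounts for the differential of the shift by -1. *)
pose g0 : hom_family P := fun i j x => - pcast P (j + 1 - 1) j (f i (j + 1) x).
have gn : G (- 2) (cut (- 2) g0).
  by apply: cut_of_degree => i j a x y; rewrite /g0 !linearP.
have gE i j x : j = i - 1 -> cut (- 2) g0 i (j - 1) x = - f i j x.
  move=> e; rewrite cutE; last by lia.
  rewrite /g0; congr (- _).
  have : forall a, a = j -> pcast P (a - 1) (j - 1) (f i a x) = f i j x.
    by move=> a ->; rewrite pcast_id.
  by apply; rewrite subrK.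
exists (cut (- 2) g0) => //.
have Dgn : G (- 1) (D (- 2) (cut (- 2) g0)) := of_degree_differential gn.
have dn : G (- 1) (h - D (- 2) (cut (- 2) g0)).
  by rewrite addrC -scaleN1r; apply: of_degree_lin.
apply: in_mGP => // i j x; have [->{j}|/eqP ne] := eqVneq j (i - 1); last first.
  by have [_ ->] := dn; last exact: ne; apply: in_mM0.
apply/tens_in_mM; rewrite hom_familyD hom_familyN linearB /= -uE.
apply/eqP; rewrite subr_eq0; apply/eqP.
have := kP i (tens pi x); rewrite [X in _ - X](_ : _ = 0) // subr0 => ->.
rewrite (@differentialE _ _ _ _ _ _ (i - 1 - 1)) ?subrK // !gE ?addrK //.
rewrite -[X in X + _ = _]/(- cdiff Pbar (i - 1 - 1) (i - 1) (k i (i - 1) (tens pi x))) cdiff_bar -!fP.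
rewrite cdiff_bar /shift_sign /= opprK linearD; congr (_ + _).
by rewrite !linearN.
Qed.

End Bar.

Theorem proposition6p18 (R : comNzRingType) (m : R -> Prop) (L : ralgebra R)
    (T : complex (L : pzRingType)^c) (Tbar : complex (redL m L : pzRingType)^c) :
  complete_local_ring m ->
  noetherian_algebra L ->
  alg_free L ->
  pretilting T ->
  derived_extension (@red_map R m L : {rmorphism L -> redL m L}) T Tbar ->
  (derived_Hom_free (L := L) T T <-> derived_Hom_zero Tbar (shift Tbar (- 1))).
Proof.
move=> [_ [max_m _] complete_m] noL freeL [[P spP [r qr]] Hom_zero] [Q [q [KQ qq [s qs]]]].
have [idm _ _] := max_m.
have KP := strictly_perfect_K_projective spP.
(* [P] and [T] are related only by a roof; lifting the identity of [P] through its denominator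
   yields an actual quasi-isomorphism [p]. *)
have [w wP] := lift_exists KP (den_quasi_iso r) (chain_id P).
pose p : chain_map P T := chain_comp (num r) w.
have qp : quasi_iso p.
  apply: quasi_iso_comp => //; apply: (quasi_iso_cancel (den_quasi_iso r)).
  exact: (quasi_iso_homotopic (homotopic_sym wP) (@quasi_iso_id _ P)).
(* The derived extension is computed from some K-projective resolution [Q], which has to be compared
   with [P]. *)
have [al alP] := lift_exists KP qq p.
have qal : quasi_iso al.
  by apply: (quasi_iso_cancel qq); apply: (quasi_iso_homotopic (homotopic_sym alP)).
pose pi := (@red_map R m L : {rmorphism L -> redL m L}).
have KPbar := @extend_K_projective _ _ pi P KP.
(* The reduction of [al] is a quasi-isomorphism; lifting it through the numerator of [s] connects
   the reduction of [P] with [Tbar]. *)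
have [v vP] := lift_exists KPbar qs (extend_map pi al).
pose pbar : chain_map (extend_scalars pi P) Tbar := chain_comp (den s) v.
have qpbar : quasi_iso pbar.
  apply: quasi_iso_comp; first exact: den_quasi_iso.
  apply: (quasi_iso_cancel qs); apply: (quasi_iso_homotopic (homotopic_sym vP)).
  exact: extend_quasi_iso.
(* The pretilting condition makes the Hom complex exact in all nonzero degrees: positive degrees
   serve to split off the cocycles, degree -1 serves the converse implication. *)
have exactP n : n <> 0 -> forall f, of_degree (P := P) n f -> differential n f = 0 ->
    exists2 y, of_degree (n - 1) y & differential (n - 1) y = f.
  move=> n0; apply: exact_of_null.
  exact/(derived_Hom_zeroP KP qp (quasi_iso_shift n qp))/Hom_zero.
have projG n := of_degree_finite_projective idm noL freeL spP n.
have boundG := of_degree_bounded spP.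
have exact_pos n f : 0 < n -> of_degree (P := P) n f -> differential n f = 0 ->
    exists2 y, of_degree (n - 1) y & differential (n - 1) y = f.
  by move=> n_gt0; apply: exactP; lia.
apply: (iff_trans (derived_Hom_freeP KP qp)).
apply: (iff_trans (homotopy_freeP P)).
apply: iff_sym; apply: (iff_trans (derived_Hom_zeroP KPbar qpbar (quasi_iso_shift (- 1) qpbar))).
apply: (iff_trans (iff_sym (reduced_exactP idm noL freeL spP))).
split.
  apply: reduced_exact_H0_free => //.
  - exact: of_degree_lin.
  - exact: of_degree0.
  - exact: of_degree_differential.
  - exact: differentialK.
  - by case: complete_m.
  - by move=> x; apply: complete_local_unit.
apply: H0_free_reduced_exact => //.
- exact: of_degree_lin.
- exact: of_degree0.
- exact: of_degree_differential.
- exact: differentialK.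
- by move=> f; apply: exactP.
Qed.
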